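(* Consider a bilinear control system on $\mathbb{R}^{n+1}$ of the form $$\dot{x}(t)=\Big[A_{0}+\sum_{i=1}^{m}u_{i}(t)A_{i}\Big]x(t),\quad u\in\mathcal{U},$$ with trajectories $\varphi(t,x,u)$, and let ${}_{\mathbb{P}}E$ be a chain control set of the induced control system on $\mathbb{P}^{n}$. (i) The set ${}_{\mathbb{S}}E_{0}:=\{s\in\mathbb{S}^{n}\mid\mathbb{P}s\in{}_{\mathbb{P}}E\}$ is the unique chain control set in $\mathbb{S}^{n}$ which projects into ${}_{\mathbb{P}}E$ if and only if there is $s_{0}\in\mathbb{S}^{n}$ with $\mathbb{P}s_{0}\in{}_{\mathbb{P}}E$ and $-s_{0}\in\mathbf{R}^{c}(s_{0})$. (ii) There are two (distinct) chain control sets ${}_{\mathbb{S}}E_{1}=-{}_{\mathbb{S}}E_{2}$ in $\mathbb{S}^n$ with $${}_{\mathbb{S}}E_{1}\cup{}_{\mathbb{S}}E_{2}=\{s\in\mathbb{S}^{n}\mid\mathbb{P}s\in{}_{\mathbb{P}}E\}$$ if and only if for all $s_{0}\in\mathbb{S}^{n}$ with $\mathbb{P}s_{0}\in{}_{\mathbb{P}}E$ it holds that $-s_{0}\notin\mathbf{R}^{c}(s_{0})$. (iii) Define for $j\in\{0,1,2\}$ and $u\in\mathcal{U}$ $$V_{j}(u):=\{0\ne x\in\mathbb{R}^{n+1}\mid\mathbb{S}\varphi(t,x,u)\in{}_{\mathbb{S}}E_{j}\text{ for all }t\in\mathbb{R}\}.$$ In case (i) it follows that $V_{0}(u)\cup\{0\}$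 is a linear subspace. In case (ii) it follows for $j=1,2$ that $V_{j}(u)$ is a convex cone (i.e., $x_1,x_2\in V_j(u)$ and $\alpha,\beta>0$ imply $\alpha x_1+\beta x_2\in V_j(u)$). (iv) Let $\ell$ be the number of chain control sets on $\mathbb{P}^n$. There are $\ell_{1}$ chain control sets on $\mathbb{S}^{n}$, denoted by ${}_{\mathbb{S}}E_{1},\ldots,{}_{\mathbb{S}}E_{\ell_{1}}$, with $1\leq\ell_{1}\leq2\ell\leq2(n+1)$.
   Context: Setting. $A_i\in\mathbb{R}^{(n+1)\times(n+1)}$, $i=0,\ldots,m$; $\Omega\subset\mathbb{R}^m$ is a convex and compact neighborhood of $0$; $\mathcal{U}=\{u\in L^\infty(\mathbb{R},\mathbb{R}^m)\mid u(t)\in\Omega\text{ for almost all }t\}$. For $0\ne x\in\mathbb{R}^{n+1}$ let $\mathbb{S}x=x/\|x\|\in\mathbb{S}^n$ (unit sphere) and $\mathbb{P}x\in\mathbb{P}^n$ the corresponding point of projective space. The induced control systems on $\mathbb{S}^n$ and $\mathbb{P}^n$ have trajectories $\mathbb{S}\varphi(t,x,u)=\varphi(t,x,u)/\|\varphi(t,x,u)\|$ and $\mathbb{P}\varphi(t,\mathbb{P}x,u)=\mathbb{P}(\varphi(t,x,u))$. $\mathbb{S}^n$ carries the metric $d$ induced by a norm on $\mathbb{R}^{n+1}$ and $\mathbb{P}^n$ the metric $d(\mathbb{P}s,\mathbb{P}s')=\min\{d(s,s'),d(s,-s')\}$, $s,s'\in\mathbb{S}^n$. Chain control sets (for a control system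 on a manifold $M$ with metric $d_M$ and trajectories $\varphi_M(t,x,u)$). For constants $\varepsilon,T>0$ a controlled $(\varepsilon,T)$-chain from $x$ to $y$ consists of $k\ge1$, $x_0=x,\ldots,x_k=y\in M$, $u_0,\ldots,u_{k-1}\in\mathcal{U}$, $T_0,\ldots,T_{k-1}\ge T$ with $d_M(\varphi_M(T_j,x_j,u_j),x_{j+1})<\varepsilon$ for all $j$. If such chains exist for all $\varepsilon,T>0$, then $x$ is chain controllable to $y$, and $\mathbf{R}^c(x)$ is the set of all $y\in M$ such that $x$ is chain controllable to $y$. A nonvoid set $E\subset M$ is a chain control set if every $x\in E$ is chain controllable to every $y\in E$ and $E$ is maximal with this property. In the theorem, $\mathbf{R}^c(s_0)$ refers to the system on $\mathbb{S}^n$. *)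

(* Defs.v *)
From HB Require Import structures.
From mathcomp Require Import all_boot all_order all_algebra.
From mathcomp Require Import all_classical all_reals all_analysis.

Set Implicit Arguments.
Unset Strict Implicit.
Unset Printing Implicit Defensive.

Import Order.TTheory GRing.Theory Num.Theory.
Import numFieldNormedType.Exports.

Local Open Scope classical_set_scope.
Local Open Scope ring_scope.

Section bilinear_system.
Variables (R : realType) (n m : nat).
Implicit Types (u : R -> 'cV[R]_m) (x : 'cV[R]_n.+1).

(* Essentially bounded functions are taken as Borel representatives, without
   quotienting by equality almost everywhere. *)
Definition admissible_controls (Omega : set 'cV[R]_m) : set (R -> 'cV[R]_m) :=
  [set u : R -> 'cV[R]_m |
           (forall i, (fun t : R => u t i 0) \in Lfun lebesgue_measure +oo%E) /\
           {ae lebesgue_measure, forall t : R, Omega (u t)}].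

(* Caratheodory solution of f' = (A0 + \sum_j u_j A_j) f, f(0) = x on the whole
   real line: the differential equation in integrated form.  Continuity of f
   makes the integrand integrable on bounded intervals. *)
Definition is_trajectory (A0 : 'M[R]_n.+1) (A : 'I_m -> 'M[R]_n.+1) u x
    (f : R -> 'cV[R]_n.+1) : Prop :=
  [/\ f 0 = x,
      continuous f &
      forall (a b : R) (i : 'I_n.+1), a <= b ->
        f b i 0 - f a i 0 = \int[lebesgue_measure]_(t in `[a, b])
          ((A0 + \sum_(j < m) u t j 0 *: A j) *m f t) i 0].

End bilinear_system.

Record control_system (R : realType) (C : Type) := ControlSystem {
  state : Type;
  space : set state;
  dist : state -> state -> R;
  flow : R -> state -> C -> state;
  controls : set C }.

Arguments space {R C} c.
Arguments dist {R C} c _ _.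
Arguments flow {R C} c _ _ _.
Arguments controls {R C} c.

Section chain_control_sets.
Variables (R : realType) (C : Type) (S : control_system R C).
Implicit Types (x y : state S) (E : set (state S)).

Definition controlled_chain (eps T : R) x y : Prop :=
  exists (k : nat) (xs : nat -> state S) (us : nat -> C) (Ts : nat -> R),
    [/\ (0 < k)%N, xs 0%N = x, xs k = y,
        (forall j, (j <= k)%N -> space S (xs j)) &
        forall j, (j < k)%N ->
          [/\ controls S (us j), T <= Ts j &
              dist S (flow S (Ts j) (xs j) (us j)) (xs j.+1) < eps]].

Definition chain_controllable x y : Prop :=
  forall eps T : R, 0 < eps -> 0 < T -> controlled_chain eps T x y.

Definition chain_reachable x : set (state S) :=
  [set y | chain_controllable x y].

Definition chain_transitive E : Prop :=
  forall x y, E x -> E y -> chain_controllable x y.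

Definition chain_control_set E : Prop :=
  [/\ E !=set0, E `<=` space S, chain_transitive E &
      forall F, F `<=` space S -> chain_transitive F -> E `<=` F -> F = E].

End chain_control_sets.

Arguments chain_reachable {R C} S x.
Arguments chain_control_set {R C} S E.

Section sphere_and_projective_space.
Variables (R : realType) (n m : nat).
Local Notation V := 'cV[R]_n.+1.
Local Notation control := (R -> 'cV[R]_m).
Implicit Types (x s : V) (L : {vspace V}) (N : V -> R)
  (phi : R -> V -> control -> V) (U : set control).

Definition is_norm N : Prop :=
  [/\ forall x, N x = 0 -> x = 0,
      forall (c : R) x, N (c *: x) = `|c| * N x &
      forall x y, N (x + y) <= N x + N y].

(* The library norm on matrices is the sup norm. *)
Definition euclid_norm x : R := Num.sqrt (\sum_i x i 0 ^+ 2).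

Definition unit_sphere : set V := [set s | euclid_norm s = 1].

Definition to_sphere x : V := (euclid_norm x)^-1 *: x.

Definition sphere_system N phi U : control_system R control :=
  ControlSystem unit_sphere (fun s s' => N (s - s'))
    (fun t s u => to_sphere (phi t s u)) U.

(* Points of projective space are the lines through the origin; the point
   defined by x != 0 is <[x]>%VS. *)
Definition proj_space : set {vspace V} := [set L | \dim L = 1%N].

(* A point of the sphere on the line L, determined up to sign; see proj_distE
   and proj_flowE for the independence of the choice. *)
Definition sphere_repr L : V := to_sphere (vpick L).

Definition proj_dist N L L' : R :=
  Num.min (N (sphere_repr L - sphere_repr L'))
          (N (sphere_repr L + sphere_repr L')).

Definition proj_flow phi (t : R) L (u : control) : {vspace V} :=
  <[phi t (sphere_repr L) u]>%VS.

Definition proj_system N phi U : control_system R control :=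
  ControlSystem proj_space (proj_dist N) (proj_flow phi) U.

Definition sphere_lift (E : set {vspace V}) : set V :=
  [set s | unit_sphere s /\ E <[s]>%VS].

Definition stays_in phi (E : set V) (u : control) : set V :=
  [set x | x != 0 /\ forall t, E (to_sphere (phi t x u))].

Lemma euclid_normZ (c : R) x : euclid_norm (c *: x) = `|c| * euclid_norm x.
Proof.
rewrite /euclid_norm; under eq_bigr do rewrite mxE exprMn.
by rewrite -mulr_sumr sqrtrM ?sqr_ge0// sqrtr_sqr.
Qed.

Lemma euclid_norm_neq0 x : x != 0 -> euclid_norm x != 0.
Proof.
apply: contraNneq => x0; apply/eqP/matrixP => i j; rewrite (ord1 j) mxE.
have /eqP := x0; rewrite sqrtr_eq0 => sle0.
have s0 : \sum_k x k 0 ^+ 2 = 0.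
  by apply/le_anti; rewrite sle0 sumr_ge0// => k _; exact: sqr_ge0.
move/eqP: s0; rewrite psumr_eq0 => [/allP/(_ i)|k _]; last exact: sqr_ge0.
by rewrite mem_index_enum => /(_ isT); rewrite sqrf_eq0 => /eqP.
Qed.

Lemma sphere_repr_line s : unit_sphere s ->
  exists b : bool, sphere_repr <[s]> = (-1) ^+ b *: s.
Proof.
move=> s1; have s0 : s != 0.
  apply/eqP => s0; move: s1; rewrite /unit_sphere/= s0 -[0](scale0r (0 : V)).
  by rewrite euclid_normZ normr0 mul0r => /esym/eqP; rewrite oner_eq0.
have /vlineP[c pE] := memv_pick <[s]>%VS.
have c0 : c != 0.
  apply: contraNneq s0 => c0; move: (vpick0 <[s]>%VS).
  by rewrite pE c0 scale0r eqxx => /esym/eqP l0; rewrite -memv0 -l0 memv_line.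
exists (c < 0); rewrite /sphere_repr /to_sphere pE euclid_normZ s1 mulr1.
rewrite scalerA; congr (_ *: _); have [c_lt0|c_ge0] := ltrP c 0.
  by rewrite ltr0_norm// invrN mulNr mulVf// expr1.
by rewrite ger0_norm// mulVf.
Qed.

Lemma proj_distE N s s' : is_norm N -> unit_sphere s -> unit_sphere s' ->
  proj_dist N <[s]> <[s']> = Num.min (N (s - s')) (N (s - - s')).
Proof.
move=> [_ NZ _] /sphere_repr_line[b e] /sphere_repr_line[b' e'].
have NN x : N (- x) = N x by rewrite -scaleN1r NZ normrN1 mul1r.
have NB : N (- s + s') = N (s - s') by rewrite -NN opprD opprK.
have ND : N (- s - s') = N (s + s') by rewrite -NN opprD !opprK.
rewrite /proj_dist e e' opprK; case: b {e}; case: b' {e'};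
  rewrite ?expr1 ?expr0 ?scaleN1r ?scale1r ?opprK ?NB ?ND//.
all: by rewrite minC.
Qed.

Lemma proj_flowE phi t s u :
  (forall c x, phi t (c *: x) u = c *: phi t x u) ->
  unit_sphere s -> proj_flow phi t <[s]> u = <[phi t s u]>%VS.
Proof.
move=> phiZ /sphere_repr_line[b e]; rewrite /proj_flow e phiZ.
apply/eqP; rewrite eqEsubv -!memvE; apply/andP; split; apply/vlineP.
  by exists ((-1) ^+ b).
by exists ((-1) ^+ b); rewrite scalerA -signr_addb addbb scale1r.
Qed.

End sphere_and_projective_space.

(* Main.v *)
Require Import Defs.
From HB Require Import structures.
From mathcomp Require Import all_boot all_order all_algebra.
From mathcomp Require Import all_classical all_reals all_analysis.
From mathcomp Require Import measurable_realfun ess_sup_inf.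
From mathcomp Require Import ring lra.

Set Implicit Arguments.
Unset Strict Implicit.
Unset Printing Implicit Defensive.

Import Order.TTheory GRing.Theory Num.Theory.
Import numFieldNormedType.Exports.

Local Open Scope classical_set_scope.
Local Open Scope ring_scope.

(* Chain control sets are the classes of mutual chain controllability.  The
   whole argument rests on one estimate: if a family of sets absorbs all points
   at distance less than [eps] from its points, and two trajectories [x], [y]
   of a linear system lie in it at all times, then so does [x + y].  Indeed, if
   [x + y] stayed outside, then [x + c y] could not be small compared with
   [(1 - c) y], so a jump of size [eps] could always increase [c] by a fixed
   fraction of [1 - c], whence [c -> 1].  Applied backward and forward in time
   this gives (iii).  Applied to the lines escaping forever from a forward
   invariant region of projective space it shows that these lines form a
   subspace; its codimension is the largest dimension of a projective subspace
   contained in the region, hence the same for all controls, and it increases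
   strictly along nested regions separated by a chain control set.  So there
   are at most [n + 1] of them.  Chains on projective space lift to the sphere
   up to sign, which gives (i), (ii) and the factor 2 in (iv). *)

(** * Norms and normalisation *)

(** The estimate on sums speaks of orbits of one sequence of linear maps, whereas a chain interrupts
    the flow by arbitrary jumps. So, for the dimension count, the jumps of one closed chain are
    absorbed into the maps: a jump after [F] at [s] is realised by a rank one correction that is
    small at every [v] relative to [F *m v]. Relative smallness matters because different directions
    may be contracted at very different rates. The price is half of [eps]: regions closed under
    [eps]-steps become trapping with tolerance [eps / 2]. Lines that merely start outside a region
    have no linear structure; escape at all times does. Its negation only gives every line of a
    complement its own absorption time, and compactness turns these into one time, hence one
    injective linear map carrying the whole complement into the region. The regions live at fixed
    [eps] and [T]. Such constants separate only finitely many classes at once, so the bound is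
    proved for finite injective families, and finiteness is deduced from it. *)

Section matrix_topology.
Variable R : realType.

Lemma coord_le_mx_norm p q (A : 'M[R]_(p, q)) i j : `|A i j| <= `|A|.
Proof.
by rewrite [`|A|]mx_normrE; apply/bigmax_geP; right => /=; exists (i, j).
Qed.

Lemma mx_norm_le p q (A : 'M[R]_(p, q)) (M : R) :
  0 <= M -> (forall i j, `|A i j| <= M) -> `|A| <= M.
Proof.
by move=> M0 AM; rewrite [`|A|]mx_normrE; apply/bigmax_leP; split.
Qed.

Lemma lipschitz_map_continuous (V W : normedModType R) (f : V -> W) (C : R) :
  (forall x y, `|f x - f y| <= C * `|x - y|) -> continuous f.
Proof.
move=> fC x; apply/cvgrPdist_lt => d d0.
have C0 : 0 < `|C| + 1 by rewrite ltr_wpDl.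
near=> y; apply: (le_lt_trans (fC x y)).
apply: (@le_lt_trans _ _ ((`|C| + 1) * `|x - y|)).
  by rewrite ler_wpM2r// (le_trans (ler_norm _))// lerDl.
rewrite mulrC -ltr_pdivlMr//.
near: y; have /cvgrPdist_lt := @cvg_id _ (nbhs x); apply.
exact: divr_gt0.
Unshelve. all: end_near. Qed.

Lemma bounded_closed_compact_cV p (A : set 'cV[R]_p) (M : R) :
  (forall x, A x -> `|x| <= M) -> closed A -> compact A.
Proof.
move=> AM Acl.
have ctr k l : continuous (@trmx R k l).
  apply: (@lipschitz_map_continuous _ _ _ 1) => x y; rewrite mul1r -linearB.
  by apply: mx_norm_le => // i j; rewrite mxE coord_le_mx_norm.
have -> : A = trmx @` ((trmx : 'rV[R]_p -> _) @^-1` A).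
  apply/seteqP; split=> [x Ax|_ [y Ay <-]//].
  by exists x^T; rewrite /preimage/= trmxK.
apply: continuous_compact; first exact/continuous_subspaceT/ctr.
apply: bounded_closed_compact.
  exists M; split; first exact: num_real.
  move=> K MK y /AM; rewrite -{2}(trmxK y) => yM; apply: le_trans (ltW MK).
  apply: le_trans yM; apply: mx_norm_le => // i j.
  by rewrite mxE coord_le_mx_norm.
exact: (closed_comp (fun _ _ => @ctr _ _ _)).
Qed.

End matrix_topology.

Section euclidean_norm.
Variables (R : realType) (n : nat).
Local Notation V := 'cV[R]_n.+1.
Implicit Types (x y s v w : V) (N : V -> R).
Local Notation e := (@euclid_norm R n).

Definition dot x y : R := \sum_i x i 0 * y i 0.

Lemma euclid_norm_ge0 x : 0 <= e x.
Proof. exact: sqrtr_ge0. Qed.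

Lemma euclid_norm_gt0 x : x != 0 -> 0 < e x.
Proof. by move=> x0; rewrite lt_def euclid_norm_neq0// euclid_norm_ge0. Qed.

Lemma euclid_norm0 : e 0 = 0.
Proof. by rewrite -(scale0r (0 : V)) euclid_normZ normr0 mul0r. Qed.

Lemma euclid_normN x : e (- x) = e x.
Proof. by rewrite -scaleN1r euclid_normZ normrN1 mul1r. Qed.

Lemma euclid_norm_sqr x : e x ^+ 2 = \sum_i x i 0 ^+ 2.
Proof. by rewrite sqr_sqrtr// sumr_ge0// => i _; exact: sqr_ge0. Qed.

(** Cauchy-Schwarz. For unit vectors it is the inequality of means summed over the coordinates;
    normalising gives the general case, and the two signs [c] give the absolute value. *)
Lemma norm_dot_le x y : `|dot x y| <= e x * e y.
Proof.
have unit_le a b : e a = 1 -> e b = 1 -> dot a b <= 1.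
  move=> ea eb; have -> : 1 = \sum_i ((a i 0 ^+ 2 + b i 0 ^+ 2) / 2) :> R.
    rewrite -mulr_suml big_split/= -!euclid_norm_sqr ea eb; lra.
  by apply: ler_sum => i _; have := sqr_ge0 (a i 0 - b i 0); nra.
have dotZl c a b : dot (c *: a) b = c * dot a b.
  by rewrite /dot mulr_sumr; apply: eq_bigr => i _; rewrite mxE mulrA.
have dotZr c a b : dot a (c *: b) = c * dot a b.
  by rewrite /dot mulr_sumr; apply: eq_bigr => i _; rewrite mxE mulrCA.
have [->|x0] := eqVneq x 0.
  by rewrite -(scale0r (0 : V)) dotZl mul0r normr0 mulr_ge0// euclid_norm_ge0.
have [->|y0] := eqVneq y 0.
  by rewrite -(scale0r (0 : V)) dotZr mul0r normr0 mulr_ge0// euclid_norm_ge0.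
have ex := euclid_norm_gt0 x0; have ey := euclid_norm_gt0 y0.
have eS a : 0 < e a -> e ((e a)^-1 *: a) = 1.
  by move=> ea; rewrite euclid_normZ ger0_norm ?invr_ge0 ?ltW// mulVf ?gt_eqF.
have le1 : forall c, `|c| = 1 -> c * dot x y <= e x * e y.
  move=> c c1; have := unit_le (c *: ((e x)^-1 *: x)) ((e y)^-1 *: y).
  rewrite euclid_normZ c1 mul1r !eS// => /(_ erefl erefl).
  rewrite !(dotZl, dotZr) => le1.
  rewrite -(ler_pM2l (_ : 0 < (e x)^-1 * (e y)^-1)); last first.
    by rewrite mulr_gt0// invr_gt0.
  apply: le_trans (_ : 1 <= _); first by rewrite -mulrA mulrCA mulrCA in le1 *; lra.
  by rewrite mulrACA !mulVf ?gt_eqF// mulr1.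
rewrite ler_norml; apply/andP; split.
  by have := le1 (-1) (normrN1 _); rewrite mulN1r lerNl.
by have := le1 1 (normr1 _); rewrite mul1r.
Qed.

Lemma ler_euclid_normD x y : e (x + y) <= e x + e y.
Proof.
rewrite -ler_sqr ?nnegrE ?addr_ge0 ?euclid_norm_ge0//.
rewrite sqrrD !euclid_norm_sqr.
have -> : \sum_i (x + y) i 0 ^+ 2 =
    \sum_i x i 0 ^+ 2 + dot x y *+ 2 + \sum_i y i 0 ^+ 2.
  rewrite /dot -sumrMnl -!big_split; apply: eq_bigr => i _ /=.
  by rewrite mxE sqrrD.
rewrite lerD2r lerD2l ler_pMn2r//.
exact: le_trans (ler_norm _) (norm_dot_le _ _).
Qed.

Lemma euclid_norm_to_sphere x : x != 0 -> e (to_sphere x) = 1.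
Proof.
move=> x0; rewrite euclid_normZ ger0_norm ?invr_ge0 ?euclid_norm_ge0//.
by rewrite mulVf// euclid_norm_neq0.
Qed.

Lemma norm_coord_le_euclid x i : `|x i 0| <= e x.
Proof.
rewrite -ler_sqr ?nnegrE ?euclid_norm_ge0// euclid_norm_sqr real_normK ?num_real//.
by rewrite (bigD1 i)//= lerDl sumr_ge0// => j _; exact: sqr_ge0.
Qed.

Lemma mx_norm_le_euclid x : `|x| <= e x.
Proof.
apply: mx_norm_le; first exact: euclid_norm_ge0.
by move=> i j; rewrite (ord1 j) norm_coord_le_euclid.
Qed.

Lemma euclid_le_mx_norm x : e x <= n.+1%:R * `|x|.
Proof.
rewrite -ler_sqr ?nnegrE ?euclid_norm_ge0 ?mulr_ge0// euclid_norm_sqr.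
apply: (@le_trans _ _ (\sum_(i < n.+1) `|x| ^+ 2)).
  apply: ler_sum => i _; rewrite -real_normK ?num_real// ler_sqr ?nnegrE//.
  exact: coord_le_mx_norm.
rewrite sumr_const card_ord -[_ *+ _]mulr_natl exprMn ler_wpM2r ?sqr_ge0//.
by rewrite ler_eXnr// ler1n.
Qed.

End euclidean_norm.

Section norm_estimates.
Variables (R : realType) (n : nat).
Local Notation V := 'cV[R]_n.+1.
Implicit Types (x y s v w : V).
Local Notation e := (@euclid_norm R n).

Lemma euclid_norm_dist x y : `|e y - e x| <= e (x - y).
Proof.
have le_e a b : e a - e b <= e (a - b).
  by rewrite lerBlDr (le_trans _ (ler_euclid_normD _ _))// subrK.
by rewrite distrC ler_norml le_e lerNl opprB -(euclid_normN (x - y)) opprB le_e.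
Qed.

Lemma euclid_norm_continuous : continuous (e : V -> R).
Proof.
apply: (@lipschitz_map_continuous _ _ _ _ n.+1%:R) => x y.
by rewrite distrC (le_trans (euclid_norm_dist _ _))// euclid_le_mx_norm.
Qed.

Lemma compact_unit_sphere : compact (@unit_sphere R n).
Proof.
apply: (@bounded_closed_compact_cV _ _ _ 1).
  by move=> x /= x1; rewrite -x1 mx_norm_le_euclid.
apply: (@closed_comp _ _ e [set 1]).
  by move=> x _; exact: euclid_norm_continuous.
exact: closed_eq.
Qed.

Variables (N : V -> R) (N_norm : is_norm N).

Lemma is_normN x : N (- x) = N x.
Proof. by case: N_norm => _ NZ _; rewrite -scaleN1r NZ normrN1 mul1r. Qed.

Lemma is_norm0 : N 0 = 0.
Proof.
by case: N_norm => _ NZ _; rewrite -(scale0r (0 : V)) NZ normr0 mul0r.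
Qed.

Lemma is_norm_ge0 x : 0 <= N x.
Proof.
case: N_norm => _ _ ND; have := ND x (- x); rewrite subrr is_norm0 is_normN.
by rewrite -mulr2n pmulrn_lge0.
Qed.

Lemma is_norm_le_euclid : exists2 K, 0 < K & forall x, N x <= K * e x.
Proof.
case: N_norm => _ NZ ND.
exists (1 + \sum_i N (delta_mx i 0)).
  by rewrite ltr_wpDr// sumr_ge0// => i _; exact: is_norm_ge0.
move=> x; apply: (@le_trans _ _ (\sum_i N (x i 0 *: delta_mx i 0))).
  rewrite {1}[x]matrix_sum_delta; under eq_bigr do rewrite big_ord1.
  elim/big_ind2 : _ => //; first by rewrite is_norm0.
  by move=> a b c d ab cd; apply: le_trans (ND _ _) (lerD ab cd).
rewrite mulrDl mul1r ler_wpDl ?euclid_norm_ge0// mulr_suml ler_sum// => i _.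
by rewrite NZ mulrC ler_wpM2l ?is_norm_ge0// norm_coord_le_euclid.
Qed.

(** [K] is the inverse of the minimum of [N] on the compact Euclidean sphere, which is positive
    because [N] vanishes only at 0. *)
Lemma euclid_le_is_norm : exists2 K, 0 < K & forall x, e x <= K * N x.
Proof.
have [K K0 NK] := is_norm_le_euclid; case: N_norm => N0 NZ ND.
have cN : continuous (N : V -> R).
  apply: (@lipschitz_map_continuous _ _ _ _ (K * n.+1%:R)) => x y.
  have le_N a b : N a - N b <= N (a - b).
    by rewrite lerBlDr (le_trans _ (ND _ _))// subrK.
  apply: (@le_trans _ _ (N (x - y))).
    by rewrite ler_norml le_N lerNl opprB -(is_normN (x - y)) opprB le_N.
  by apply: le_trans (NK _) _; rewrite -mulrA ler_pM2l//; exact: euclid_le_mx_norm.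
have e1 : (const_mx 1 : V) != 0.
  by apply/eqP => /matrixP/(_ 0 0)/eqP; rewrite !mxE oner_eq0.
have S0 : @unit_sphere R n !=set0.
  by exists (to_sphere (const_mx 1)); exact: euclid_norm_to_sphere.
have [s + smin] := compact_EVT_min S0 compact_unit_sphere
  (@continuous_subspaceT _ _ (@unit_sphere R n) (N : V -> R) cN).
rewrite inE => s1.
have Ns : 0 < N s.
  rewrite lt_def is_norm_ge0 andbT; apply/eqP => /N0 s0.
  by move: s1; rewrite s0 /unit_sphere/= euclid_norm0 => /eqP; rewrite eq_sym oner_eq0.
exists (N s)^-1 => [|x]; first by rewrite invr_gt0.
have [->|x0] := eqVneq x 0; first by rewrite euclid_norm0 is_norm0 mulr0.
have := smin (to_sphere x); rewrite inE => /(_ (euclid_norm_to_sphere x0)).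
rewrite NZ ger0_norm ?invr_ge0 ?euclid_norm_ge0//.
by rewrite ler_pdivlMl ?euclid_norm_gt0// mulrC -ler_pdivlMl.
Qed.

(* Both normalisations cost a factor [1 / e w]: compare [v / e v] and [w / e w]
   through [v / e w]. *)
Lemma to_sphere_lipschitz : exists2 K, 0 < K & forall v w, v != 0 -> w != 0 ->
  N (to_sphere v - to_sphere w) <= K * (e (v - w) / e w).
Proof.
have [K K0 NK] := is_norm_le_euclid; exists (K * 2); first by rewrite mulr_gt0.
move=> v w v0 w0; apply: le_trans (NK _) _; rewrite -mulrA ler_pM2l//.
have ev := euclid_norm_gt0 v0; have ew := euclid_norm_gt0 w0.
have -> : to_sphere v - to_sphere w =
    ((e v)^-1 - (e w)^-1) *: v + (e w)^-1 *: (v - w).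
  by rewrite /to_sphere scalerBr scalerBl addrA subrK.
apply: le_trans (ler_euclid_normD _ _) _; rewrite !euclid_normZ.
rewrite (gtr0_norm (_ : 0 < (e w)^-1)) ?invr_gt0//.
have -> : 2 * (e (v - w) / e w) = e (v - w) / e w + (e w)^-1 * e (v - w).
  by field; rewrite gt_eqF.
rewrite lerD2r.
have -> : `|(e v)^-1 - (e w)^-1| * e v = `|e w - e v| / e w.
  have -> : (e v)^-1 - (e w)^-1 = (e w - e v) / (e v * e w).
    by field; rewrite !gt_eqF.
  rewrite normrM (gtr0_norm (_ : 0 < (_ * _)^-1)) ?invr_gt0 ?mulr_gt0//.
  by field; rewrite !gt_eqF.
by rewrite ler_pM2r ?invr_gt0// euclid_norm_dist.
Qed.

End norm_estimates.

(** * Stability of positive combinations *)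

Section positive_combinations.
Variables (R : realType) (n : nat).
Local Notation V := 'cV[R]_n.+1.
Local Notation e := (@euclid_norm R n).

Lemma exp_lt_small (q d : R) : 0 <= q < 1 -> 0 < d -> exists i, q ^+ i < d.
Proof.
move=> /andP[q0 q1] d0.
have /cvgrPdist_lt/(_ d d0)[i _ /(_ i)/=] : q ^+ i @[i --> \oo] --> (0 : R).
  by apply: cvg_expr; rewrite ger0_norm.
by rewrite leqnn sub0r normrN ger0_norm ?exprn_ge0// => /(_ isT); exists i.
Qed.

(* In the applications [P j a b] says that [a x + b y] lies in some region at
   time [j]; it need not refer to [x j] and [y j], so that time shifts between
   the region and the metric are allowed. *)
Lemma positive_combination_stable (N : V -> R) (eps : R) (x y : nat -> V)
    (P : nat -> R -> R -> Prop) :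
  is_norm N -> 0 < eps ->
  let admissible a b := [/\ 0 <= a, 0 <= b & 0 < a + b] in
  (forall j a b, admissible a b -> a *: x j + b *: y j != 0) ->
  (forall j a b, admissible a b -> P j.+1 a b -> P j a b) ->
  (forall a b, admissible a b -> (forall j, P j a b) ->
     forall j a' b', admissible a' b' ->
     N (to_sphere (a *: x j + b *: y j) -
        to_sphere (a' *: x j + b' *: y j)) < eps -> P j a' b') ->
  (forall j, P j 1 0) -> (forall j, P j 0 1) -> forall j, P j 1 1.
Proof.
move=> N_norm eps0 adm xy0 P_mono P_move Px Py j0; apply: contrapT => nP0.
have [K K0 NK] := to_sphere_lipschitz N_norm.
have adm1 c : 0 <= c -> adm 1 c.
  by move=> c0; split=> //; rewrite ltr_pwDl.
have adm11 : adm 1 1 by exact: adm1.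
have adm01 : adm 0 1 by split=> //; rewrite add0r.
have P_monoD k j a b : adm a b -> P (k + j)%N a b -> P j a b.
  by move=> ab; elim: k => // k IHk; rewrite addSn => /(P_mono _ _ _ ab).
have nP j : ~ P (j + j0)%N 1 1 by move/(P_monoD _ _ _ _ adm11).
(* [k] is the fraction of the gap [1 - c] gained per jump. The gain moves the direction by at most
   [K * k] times [q ^+ i * e (y l) / e p], a ratio that [eps_le] below bounds by [K / eps]; so this
   condition keeps the move below [eps]. *)
have [k [k0 k1 kK]] : exists k, [/\ 0 < k, k < 1 & k * K ^+ 2 < eps ^+ 2].
  have r0 : 0 < eps ^+ 2 / K ^+ 2 by rewrite divr_gt0// exprn_gt0.
  exists (Num.min (eps ^+ 2 / K ^+ 2) 1 / 2); split.
  - by rewrite divr_gt0// lt_min r0 ltr01.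
  - rewrite ltr_pdivrMr// mul1r (le_lt_trans (_ : _ <= 1)) ?ltr1n//.
    by rewrite ge_min lexx orbT.
  - rewrite -ltr_pdivlMr ?exprn_gt0// ltr_pdivrMr//.
    apply: le_lt_trans (_ : eps ^+ 2 / K ^+ 2 < _); first by rewrite ge_min lexx.
    by rewrite ltr_pMr ?ltr1n.
have [q qE] : exists q, q = 1 - k by exists (1 - k).
have q0 : 0 < q by rewrite qE subr_gt0.
have q01 : 0 <= q < 1 by rewrite ltW//= qE ltrBlDr ltrDl.
have qi1 i : 0 <= 1 - q ^+ i.
  by case/andP: q01 => ? ?; rewrite subr_ge0 exprn_ile1// ltW.
have P_near i j : P j 1 (1 - q ^+ i).
  elim: i j => [|i IHi] j; first by rewrite expr0 subrr; exact: Px.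
  (* The jump is made [j0] steps later, where [nP] excludes [x + y], and [P_mono] carries the result
     back to [j]. *)
  apply: (P_monoD j0); first exact: adm1.
  rewrite addnC; set l := (j + j0)%N.
  apply: (P_move 1 (1 - q ^+ i)) => //; [exact: adm1|exact: adm1|].
  have qi0 : 0 < q ^+ i by rewrite exprn_gt0.
  rewrite !scale1r; set p := x l + (1 - q ^+ i) *: y l.
  have p0 : p != 0 by have := xy0 l _ _ (adm1 _ (qi1 i)); rewrite scale1r.
  have y0 : y l != 0.
    by have := xy0 l _ _ adm01; rewrite scale0r scale1r add0r.
  have qy0 : q ^+ i *: y l != 0 by rewrite scaler_eq0 negb_or gt_eqF.
  have z0 : x l + y l != 0 by have := xy0 l _ _ adm11; rewrite !scale1r.
  have ep := euclid_norm_gt0 p0; have ey := euclid_norm_gt0 y0.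
  (* Otherwise [x l + y l], which is [p + q ^+ i *: y l], would be within [eps] of [y l] in
     direction; since the combination [(0, 1)] is always in the region, one jump would put [x + y]
     inside. *)
  have eps_le : eps * (q ^+ i * e (y l)) <= K * e p.
    rewrite leNgt; apply/negP => lt_eps; apply: (nP j).
    apply: (P_move 0 1 adm01) => //.
    rewrite scale0r !scale1r add0r -(is_normN N_norm) opprB.
    have -> : to_sphere (y l) = to_sphere (q ^+ i *: y l).
      rewrite /to_sphere euclid_normZ gtr0_norm// invfM mulrC scalerA.
      by rewrite mulfVK ?gt_eqF.
    apply: le_lt_trans (NK _ _ z0 qy0) _.
    have -> : x l + y l - q ^+ i *: y l = p.
      by rewrite /p scalerBl scale1r addrA.
    by rewrite euclid_normZ gtr0_norm// mulrA ltr_pdivrMr ?mulr_gt0.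
  rewrite -(is_normN N_norm) opprB.
  have p'0 : x l + (1 - q ^+ i.+1) *: y l != 0.
    by have := xy0 l _ _ (adm1 _ (qi1 i.+1)); rewrite scale1r.
  apply: le_lt_trans (NK _ _ p'0 p0) _.
  have -> : x l + (1 - q ^+ i.+1) *: y l - p = (q ^+ i * k) *: y l.
    rewrite /p opprD addrACA subrr add0r -scalerBl; congr (_ *: _).
    by rewrite exprSr qE; ring.
  have qk0 : 0 < q ^+ i * k by exact: mulr_gt0.
  rewrite euclid_normZ (gtr0_norm qk0) mulrA ltr_pdivrMr//.
  rewrite -(ltr_pM2l eps0) (_ : eps * _ = (eps * (q ^+ i * e (y l))) * (k * K)).
    apply: le_lt_trans (_ : (K * e p) * (k * K) < _).
      by rewrite ler_pM2r// mulr_gt0.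
    rewrite (_ : K * e p * (k * K) = k * K ^+ 2 * e p); last by ring.
    by rewrite [ltRHS]mulrA -expr2 ltr_pM2r.
  by move: (q ^+ i) (e (y l)) => a b; ring.
have y0 : y j0 != 0.
  by have := xy0 j0 _ _ adm01; rewrite scale0r scale1r add0r.
have z0 : x j0 + y j0 != 0 by have := xy0 j0 _ _ adm11; rewrite !scale1r.
have ey := euclid_norm_gt0 y0; have ez := euclid_norm_gt0 z0.
(* At the fixed time [j0] the combinations of [P_near] converge in direction to [x + y], so one last
   jump contradicts [nP0]. *)
have [i qi] : exists i, q ^+ i < eps * e (x j0 + y j0) / (K * e (y j0)).
  by apply: exp_lt_small => //; rewrite divr_gt0 ?mulr_gt0.
apply: nP0; apply: (P_move 1 (1 - q ^+ i)) => //; first exact: adm1.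
rewrite !scale1r; apply: le_lt_trans (NK _ _ _ z0) _.
  by have := xy0 j0 _ _ (adm1 _ (qi1 i)); rewrite scale1r.
have -> : x j0 + (1 - q ^+ i) *: y j0 - (x j0 + y j0) = (- q ^+ i) *: y j0.
  by rewrite scalerBl scale1r scaleNr opprD addrACA subrr add0r addrC addKr.
rewrite euclid_normZ normrN gtr0_norm ?exprn_gt0// mulrA ltr_pdivrMr//.
by rewrite mulrCA -ltr_pdivlMr// mulr_gt0.
Qed.

End positive_combinations.

(** * Chains *)

Section chains.
Variables (R : realType) (C : Type) (S : control_system R C).
Local Notation space := Defs.space.
Implicit Types (x y z : state S) (E : set (state S)) (eps T : R).

Definition chain_step eps T x y : Prop :=
  [/\ space S x, space S y &
      exists u t, [/\ controls S u, T <= t & dist S (flow S t x u) y < eps]].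

Lemma chain_step_chain eps T x y :
  chain_step eps T x y -> controlled_chain eps T x y.
Proof.
move=> [Sx Sy [u [t [Uu Tt d]]]].
exists 1%N, (fun j => if j == 0%N then x else y), (fun=> u), (fun=> t).
by split=> //; [case=> [|j]//|case].
Qed.

Lemma controlled_chain_space eps T x y :
  controlled_chain eps T x y -> space S x /\ space S y.
Proof.
move=> [k [xs [us [Ts [k0 <- <- Sxs _]]]]].
by split; apply: Sxs.
Qed.

Lemma controlled_chain_trans eps T x y z :
  controlled_chain eps T x y -> controlled_chain eps T y z ->
  controlled_chain eps T x z.
Proof.
move=> [k [xs [us [Ts [k0 x0 xk Sxs step]]]]].
move=> [l [ys [vs [Us [l0 y0 yl Sys step']]]]].
pose cat (W : Type) (a b : nat -> W) j := if (j < k)%N then a j else b (j - k)%N.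
exists (k + l)%N, (cat _ xs ys), (cat _ us vs), (cat _ Ts Us); split.
- by rewrite addn_gt0 k0.
- by rewrite /cat k0.
- by rewrite /cat ltnNge leq_addr/= addKn.
- move=> j jkl; rewrite /cat; case: ltnP => jk; first by apply: Sxs; exact: ltnW.
  by apply: Sys; rewrite leq_subLR.
- move=> j jkl; rewrite /cat; have [jk|jk] := ltnP j k.
    have := step _ jk; case: ltnP => // kj.
    have -> : j.+1 = k by apply/eqP; rewrite eqn_leq jk.
    by rewrite subnn xk -y0.
  rewrite ltnNge (leq_trans jk (leqnSn j))/= subSn//.
  by apply: step'; rewrite ltn_subLR.
Qed.

Lemma le_controlled_chain eps eps' T T' x y : eps <= eps' -> T' <= T ->
  controlled_chain eps T x y -> controlled_chain eps' T' x y.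
Proof.
move=> le_eps leT [k [xs [us [Ts [k0 x0 xk Sxs step]]]]].
exists k, xs, us, Ts; split=> // j /step[Uu Tt d]; split=> //.
  exact: le_trans Tt.
exact: lt_le_trans le_eps.
Qed.

(** A chain has at least one step, so the base case is a step from [x] and not [x] itself. *)
Lemma controlled_chain_ind eps T x (Q : set (state S)) :
  (forall y, chain_step eps T x y -> Q y) ->
  (forall y z, Q y -> chain_step eps T y z -> Q z) ->
  forall y, controlled_chain eps T x y -> Q y.
Proof.
move=> Q0 QS y [k [xs [us [Ts [k0 x0 xk Sxs step]]]]].
have xstep j : (j < k)%N -> chain_step eps T (xs j) (xs j.+1).
  move=> jk; split; [exact/Sxs/ltnW|exact: Sxs|].
  by exists (us j), (Ts j); exact: step.
case: k k0 xk {Sxs step} xstep => // k _ <- xstep.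
suff: forall j, (j <= k)%N -> Q (xs j.+1) by apply.
elim=> [|j IHj] jk; first by apply: Q0; rewrite -x0; exact: xstep.
by apply: QS (IHj (ltnW jk)) _; exact: xstep.
Qed.

Definition forward_closed eps T (A : set (state S)) : Prop :=
  forall x y, A x -> chain_step eps T x y -> A y.

Lemma chain_controllable_trans x y z :
  chain_controllable x y -> chain_controllable y z -> chain_controllable x z.
Proof.
move=> xy yz eps T eps0 T0.
exact: controlled_chain_trans (xy _ _ eps0 T0) (yz _ _ eps0 T0).
Qed.

Lemma chain_controllable_space x y :
  chain_controllable x y -> space S x /\ space S y.
Proof. by move=> /(_ 1 1 ltr01 ltr01)/controlled_chain_space. Qed.

(** Mutual controllability is not reflexive in general: the class is nonempty exactly when [x] is
    chain controllable to itself. *)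
Definition chain_class x : set (state S) :=
  [set y | chain_controllable x y /\ chain_controllable y x].

Lemma chain_class_sub x : chain_class x `<=` space S.
Proof. by move=> y [/chain_controllable_space[]]. Qed.

Lemma chain_control_set_class x :
  chain_controllable x x -> chain_control_set S (chain_class x).
Proof.
move=> xx; split; [by exists x|exact: chain_class_sub| |].
  by move=> y z [_ yx] [xz _]; exact: chain_controllable_trans yx xz.
move=> F _ Ftr xF; apply/seteqP; split=> // y Fy.
by split; apply: Ftr => //; exact: xF.
Qed.

Lemma chain_control_setE E x : chain_control_set S E -> E x ->
  E = chain_class x.
Proof.
move=> [_ ES Etr Emax] Ex; have xx := Etr _ _ Ex Ex.
apply/esym/Emax; first exact: chain_class_sub.
  by case: (chain_control_set_class xx).
by move=> y Ey; split; exact: Etr.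
Qed.

Lemma not_chain_controllable x y : ~ chain_controllable x y ->
  exists eps T, [/\ 0 < eps, 0 < T & ~ controlled_chain eps T x y].
Proof.
move=> nxy; apply: contrapT => noET; apply: nxy => eps T eps0 T0.
by apply: contrapT => nc; apply: noET; exists eps, T.
Qed.

End chains.

(** Reduces both finiteness and the bound on the cardinal to finite injective families, the form in
    which the dimension argument bounds the number of chain control sets. An infinite set would
    contain such a family with [b.+1] members. *)
Lemma card_eq_II_bound (T : pointedType) (A : set T) (b : nat) :
  (forall k (f : nat -> T), (forall i, (i < k)%N -> A (f i)) ->
    (forall i j, (i < k)%N -> (j < k)%N -> f i = f j -> i = j) -> (k <= b)%N) ->
  exists2 l, (l <= b)%N & (A #= `I_l)%card.
Proof.
move=> A_le; have [/finite_setP[l Al]|infA] := pselect (finite_set A).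
  exists l => //; move: (Al); rewrite card_eq_sym => /card_set_bijP[f [fA f_inj _]].
  apply: (A_le l f) => [i il|i j il jl]; first exact: fA.
  by apply: f_inj; rewrite inE.
have /pcard_leP[f] : ([set: nat] #<= A)%card by exact/infiniteP.
suff : (b.+1 <= b)%N by rewrite ltnn.
by apply: (A_le _ f) => [i _|i j _ _]; [exact: funS|apply: inj; rewrite inE].
Qed.

Section to_sphere_theory.
Variables (R : realType) (n : nat).
Local Notation V := 'cV[R]_n.+1.
Implicit Types (x y s v w : V).

Lemma to_sphereZ (c : R) x : 0 < c -> to_sphere (c *: x) = to_sphere x.
Proof.
move=> c0; rewrite /to_sphere euclid_normZ gtr0_norm// invfM mulrC scalerA.
by rewrite mulfVK ?gt_eqF.
Qed.

Lemma to_sphereN x : to_sphere (- x) = - to_sphere x.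
Proof. by rewrite /to_sphere euclid_normN scalerN. Qed.

Lemma to_sphere_id s : unit_sphere s -> to_sphere s = s.
Proof. by rewrite /unit_sphere /to_sphere/= => ->; rewrite invr1 scale1r. Qed.

Lemma unit_sphere_neq0 s : unit_sphere s -> s != 0.
Proof.
rewrite /unit_sphere/= => s1; apply/eqP => s0; move/eqP: s1.
by rewrite s0 euclid_norm0 eq_sym oner_eq0.
Qed.

Lemma unit_sphereN s : unit_sphere s -> unit_sphere (- s).
Proof. by rewrite /unit_sphere/= euclid_normN. Qed.

Lemma to_sphereK x : x != 0 -> euclid_norm x *: to_sphere x = x.
Proof.
by move=> x0; rewrite scalerA divff ?scale1r// euclid_norm_neq0.
Qed.

Lemma vlineZ (c : R) x : c != 0 -> (<[c *: x]> = <[x]>)%VS.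
Proof.
move=> c0; apply/eqP; rewrite eqEsubv -!memvE memvZ ?memv_line//=.
by rewrite -{1}(scale1r x) -(mulVf c0) -scalerA memvZ ?memv_line.
Qed.

Lemma vlineN x : (<[- x]> = <[x]>)%VS.
Proof. by rewrite -scaleN1r vlineZ// oppr_eq0 oner_eq0. Qed.

Lemma vline_to_sphere x : x != 0 -> (<[to_sphere x]> = <[x]>)%VS.
Proof. by move=> x0; rewrite vlineZ// invr_neq0// euclid_norm_neq0. Qed.

Lemma sphere_reprP (L : {vspace V}) : proj_space L ->
  unit_sphere (sphere_repr L) /\ (<[sphere_repr L]> = L)%VS.
Proof.
rewrite /proj_space/= => dL; have pL0 : vpick L != 0.
  by rewrite vpick0 -dimv_eq0 dL.
split; first exact: euclid_norm_to_sphere.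
rewrite vline_to_sphere//; apply/eqP.
by rewrite eqEdim -memvE memv_pick dim_vline pL0 dL.
Qed.

Lemma proj_space_line x : x != 0 -> proj_space <[x]>%VS.
Proof. by move=> x0; rewrite /proj_space/= dim_vline x0. Qed.

End to_sphere_theory.

(** * Trapping regions of sequences of linear maps *)

Section linear_maps.
Variables (R : realType) (n : nat).
Local Notation V := 'cV[R]_n.+1.
Local Notation e := (@euclid_norm R n).

Lemma linear_mulmx (f : V -> V) : linear f ->
  exists F : 'M[R]_n.+1, forall x, f x = F *m x.
Proof.
move=> lf; exists (\matrix_(i, j) f (delta_mx j 0) i 0) => x.
have f0 : f 0 = 0.
  by have := lf (-1) 0 0; rewrite scaler0 addr0 scaleN1r addNr.
have fZ c y : f (c *: y) = c *: f y by have := lf c y 0; rewrite f0 !addr0.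
have sumE (I : Type) (r : seq I) (h : I -> V) :
    f (\sum_(i <- r) h i) = \sum_(i <- r) f (h i).
  elim/big_rec2 : _ => // i a b _ <-.
  by have := lf 1 (h i) b; rewrite !scale1r.
rewrite {1}[x]matrix_sum_delta; under eq_bigr do rewrite big_ord1.
rewrite sumE; apply/matrixP => i k; rewrite (ord1 k) mxE summxE.
by apply: eq_bigr => j _; rewrite fZ !mxE mulrC.
Qed.

Lemma mulmx_bounded (F : 'M[R]_n.+1) :
  exists2 C, 0 < C & forall x : V, e (F *m x) <= C * e x.
Proof.
exists (n.+1%:R * (1 + \sum_i \sum_j `|F i j|)).
  rewrite mulr_gt0// ltr_wpDr// sumr_ge0// => i _.
  by rewrite sumr_ge0.
move=> x; apply: le_trans (euclid_le_mx_norm _) _.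
rewrite -mulrA ler_pM2l//; apply: mx_norm_le => [|i j].
  rewrite mulr_ge0 ?euclid_norm_ge0// addr_ge0// sumr_ge0// => i _.
  by rewrite sumr_ge0.
rewrite (ord1 j) mxE; apply: le_trans (ler_norm_sum _ _ _) _.
apply: (@le_trans _ _ (\sum_k `|F i k| * e x)).
  apply: ler_sum => k _; rewrite normrM ler_wpM2l//.
  exact: norm_coord_le_euclid.
rewrite -mulr_suml ler_wpM2r ?euclid_norm_ge0//.
rewrite [in leRHS](bigD1 i)//= addrCA lerDl addr_ge0// sumr_ge0// => k _.
by rewrite sumr_ge0.
Qed.

Lemma mulmx_continuous (F : 'M[R]_n.+1) : continuous (fun x : V => F *m x).
Proof.
have [C C0 FC] := mulmx_bounded F.
apply: (@lipschitz_map_continuous _ _ _ _ (C * n.+1%:R)) => x y.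
rewrite -mulmxBr (le_trans (mx_norm_le_euclid _))// (le_trans (FC _))//.
by rewrite -mulrA ler_pM2l//; exact: euclid_le_mx_norm.
Qed.

Lemma closed_vspace (W : {vspace V}) : closed [set x | x \in W].
Proof.
have [F FE] : exists F : 'M[R]_n.+1, forall x, x - projv W x = F *m x.
  apply: linear_mulmx => c x y; rewrite linearP opprD addrACA.
  by rewrite scalerBr.
have -> : [set x | x \in W] = (fun x : V => F *m x) @^-1` [set 0].
  apply/seteqP; split=> x; rewrite /preimage/= -FE.
    by move=> xW; rewrite projv_id// subrr.
  by move/eqP; rewrite subr_eq0 => /eqP ->; exact: memv_proj.
apply: closed_comp; first by move=> x _; exact: mulmx_continuous.
exact/accessible_closed_set1/hausdorff_accessible/norm_hausdorff.
Qed.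

(** [W] has maximal dimension among the subspaces contained in [D]; a further vector of [D] would
    enlarge it. *)
Lemma vspace_of_linear_set (D : set V) : D 0 ->
  (forall c x y, D x -> D y -> D (c *: x + y)) ->
  exists W : {vspace V}, forall x, x \in W <-> D x.
Proof.
move=> D0 Dlin.
pose Q k := `[< exists W : {vspace V}, \dim W = k /\ forall x, x \in W -> D x >].
have exQ : exists k, Q k.
  exists 0%N; apply/asboolP; exists 0%VS; split; first exact: dimv0.
  by move=> x; rewrite memv0 => /eqP ->.
have Q_le k : Q k -> (k <= \dim {:V})%N.
  by move=> /asboolP[W [<- _]]; exact/dimvS/subvf.
have [k /asboolP[W [Wk WD]] k_max] := ex_maxnP exQ Q_le.
exists W => x; split; first exact: WD.
move=> Dx; apply: contrapT => /negP xW.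
have : Q (\dim (W + <[x]>)%VS).
  apply/asboolP; exists (W + <[x]>)%VS; split=> // y /memv_addP[w wW [z]].
  by move=> /vlineP[c ->] ->; rewrite addrC; apply: Dlin => //; exact: WD.
move=> /k_max; rewrite -Wk leqNgt => /negP; apply.
rewrite (ltn_neqAle (\dim W)) dimvS ?addvSl// andbT.
apply: contraNneq xW => dimE.
have /eqP -> : W == (W + <[x]>)%VS by rewrite eqEdim addvSl dimE leqnn.
by rewrite memvE addvSr.
Qed.

(** Sums need to be checked only when no nonnegative combination vanishes, which is what
    [positive_combination_stable] requires. In the remaining case [x + y] is a multiple of [x] or of
    [y]. *)
Lemma vspace_of_cone (D : set V) : D 0 ->
  (forall c x, c != 0 -> D x -> D (c *: x)) ->
  (forall x y, D x -> D y -> (forall a b : R, [/\ 0 <= a, 0 <= b & 0 < a + b] ->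
     a *: x + b *: y != 0) -> D (x + y)) ->
  exists W : {vspace V}, forall x, x \in W <-> D x.
Proof.
move=> D0 DZ0 DD; have DZ c x : D x -> D (c *: x).
  have [->|c0] := eqVneq c 0; first by rewrite scale0r.
  exact: DZ0.
apply: vspace_of_linear_set => // c x y /(DZ c); move: (c *: x) => {}x Dx Dy.
have [x0|x0] := eqVneq x 0; first by rewrite x0 add0r.
have [] := pselect (exists a b : R,
  [/\ 0 <= a, 0 <= b, 0 < a + b & a *: x + b *: y = 0]).
  move=> [a [b [a0 b0 ab axby]]].
  have [b0'|bn0] := eqVneq b 0.
    move: ab axby; rewrite b0' addr0 scale0r addr0 => ab /eqP.
    by rewrite scaler_eq0 (negbTE x0) gt_eqF.
  have -> : y = (- (b^-1 * a)) *: x.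
    apply: (scalerI bn0); rewrite scalerA mulrN mulrA divff// mul1r scaleNr.
    by apply/eqP; rewrite -addr_eq0 addrC axby.
  by rewrite -{1}[x]scale1r -scalerDl; exact: DZ.
move=> nxy; apply: DD => // a b [a0 b0 ab]; apply/eqP => axby.
by apply: nxy; exists a, b.
Qed.

End linear_maps.

Section trapping_regions.
Variables (R : realType) (n : nat).
Local Notation V := 'cV[R]_n.+1.
Local Notation e := (@euclid_norm R n).
Variables (N : V -> R) (d : R) (G : nat -> 'M[R]_n.+1).
Hypotheses (N_norm : is_norm N) (d0 : 0 < d).
Hypothesis G_neq0 : forall j (v : V), v != 0 -> G j *m v != 0.

Fixpoint iter_mx j : 'M[R]_n.+1 :=
  if j is i.+1 then G i *m iter_mx i else 1%:M.

(** Distances are taken between normalised vectors although [A] consists of lines; as [w] may be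
    replaced by [- w], both terms of the projective distance are covered. *)
Definition trapping (A : set {vspace V}) : Prop :=
  forall j v w, v != 0 -> w != 0 -> A <[v]>%VS ->
    N (to_sphere (G j *m v) - to_sphere w) < d -> A <[w]>%VS.

Lemma iter_mxS j (v : V) : iter_mx j.+1 *m v = G j *m (iter_mx j *m v).
Proof. by rewrite mulmxA. Qed.

Lemma iter_mx_neq0 j (v : V) : v != 0 -> iter_mx j *m v != 0.
Proof.
move=> v0; elim: j => [|j IHj]; first by rewrite mul1mx.
by rewrite iter_mxS G_neq0.
Qed.

Lemma trapping_iter A i j (v : V) : trapping A -> v != 0 -> (i <= j)%N ->
  A <[iter_mx i *m v]>%VS -> A <[iter_mx j *m v]>%VS.
Proof.
move=> Atr v0 /subnK <-; elim: (j - i)%N => // k IHk Av.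
apply: (Atr (k + i)%N (iter_mx (k + i) *m v)); [exact: iter_mx_neq0..|exact: IHk|].
by rewrite addSn iter_mxS subrr is_norm0.
Qed.

Lemma escape_vspace A : trapping A -> exists W : {vspace V},
  forall v, v \in W <-> (v = 0 \/ forall j, ~ A <[iter_mx j *m v]>%VS).
Proof.
move=> Atr; apply: vspace_of_cone; first by left.
  move=> c x c0 [->|Dx]; [by left; rewrite scaler0|right=> j].
  by rewrite -scalemxAr vlineZ.
move=> x y + + xy0.
have x0 : x != 0 by have := xy0 1 0; rewrite scale1r scale0r addr0 addr0; apply.
have y0 : y != 0 by have := xy0 0 1; rewrite scale1r scale0r !add0r; apply.
move=> [/eqP|Dx]; first by rewrite (negbTE x0).
move=> [/eqP|Dy]; first by rewrite (negbTE y0).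
right; pose P j (a b : R) := ~ A <[iter_mx j *m (a *: x + b *: y)]>%VS.
have combE j (a b : R) :
    a *: (iter_mx j *m x) + b *: (iter_mx j *m y) = iter_mx j *m (a *: x + b *: y).
  by rewrite mulmxDr -!scalemxAr.
suff : forall j, P j 1 1 by rewrite /P !scale1r.
(* The region is tested at [j] and the distance at [j.+1], since a jump follows [G j]: if the
   combination [a', b'] were in [A] at step [j], a jump from its image would put [a, b] in [A] at
   step [j.+1]. *)
apply: (positive_combination_stable (P := P)
  (x := fun j => iter_mx j.+1 *m x) (y := fun j => iter_mx j.+1 *m y)
  N_norm d0) => //.
- by move=> j a b ab; rewrite combE iter_mx_neq0// xy0.
- move=> j a b ab nA /(trapping_iter Atr (xy0 _ _ ab) (leqnSn j)); exact: nA.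
- move=> a b ab nA j a' b' ab'; rewrite !combE => close Aab'.
  apply: (nA j.+1); apply: (Atr j) Aab' _; rewrite ?iter_mx_neq0 ?xy0//.
  by rewrite -iter_mxS -(is_normN N_norm) opprB.
- by move=> j; rewrite /P scale1r scale0r addr0.
- by move=> j; rewrite /P scale1r scale0r add0r.
Qed.

(** Once a line is in [A], nearby initial lines are in [A] one step later, because the tolerance [d]
    covers the difference of the images; hence [j.+1]. Absorption persists, so compactness of the
    unit sphere of [W] makes the time uniform. *)
Lemma eventually_absorbed A (W : {vspace V}) : trapping A ->
  (forall v, v \in W -> v != 0 -> exists j, A <[iter_mx j *m v]>%VS) ->
  exists i, forall v, v \in W -> v != 0 -> A <[iter_mx i *m v]>%VS.
Proof.
move=> Atr WA.
have [K K0 NK] := to_sphere_lipschitz N_norm.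
pose SW := @unit_sphere R n `&` [set x | x \in W].
have cSW : compact SW.
  by apply: compact_closedI; [exact: compact_unit_sphere|exact: closed_vspace].
have near_A : \forall i \near \oo,
    SW `<=` [set v | A <[iter_mx i *m v]>%VS].
  have /near_covering_withinP := (compact_near_coveringP SW).1 cSW; apply.
  move=> x [/unit_sphere_neq0 x0 xW].
  have [j Ax] := WA _ xW x0; have [C C0 FC] := mulmx_bounded (iter_mx j.+1).
  have Fx0 := euclid_norm_gt0 (iter_mx_neq0 j.+1 x0).
  pose r := d * e (iter_mx j.+1 *m x) / (K * (C * n.+1%:R)).
  have KC0 : 0 < K * (C * n.+1%:R) by rewrite !mulr_gt0.
  have r0 : 0 < r by rewrite divr_gt0// mulr_gt0.
  near=> x' i => /= -[/unit_sphere_neq0 x'0 x'W].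
  apply: (@trapping_iter _ j.+1) => //; first by near: i; exact: nbhs_infty_ge.
  apply: (Atr j (iter_mx j *m x)); rewrite ?iter_mx_neq0// -iter_mxS.
  rewrite -(is_normN N_norm) opprB.
  apply: le_lt_trans (NK _ _ (iter_mx_neq0 _ x'0) (iter_mx_neq0 _ x0)) _.
  rewrite mulrA ltr_pdivrMr// -mulmxBr.
  apply: (@le_lt_trans _ _ (K * (C * n.+1%:R) * `|x' - x|)).
    rewrite -[leRHS]mulrA ler_pM2l// (le_trans (FC _))// -mulrA ler_pM2l//.
    exact: euclid_le_mx_norm.
  rewrite mulrC -(ltr_pdivlMr _ _ KC0) distrC.
  near: x'; have /cvgrPdist_lt := @cvg_id _ (nbhs x); exact.
have [i _ /(_ i (leqnn i)) iA] := near_A.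
exists i => v vW v0.
have := iA (to_sphere v); rewrite /= /to_sphere -scalemxAr vlineZ; last first.
  by rewrite invr_neq0// euclid_norm_neq0.
apply; split; first exact: euclid_norm_to_sphere.
by rewrite /= memvZ.
Unshelve. all: end_near. Qed.

(* The vectors whose orbits avoid [A1], resp. [A2], form subspaces [W1], resp.
   [W2], with [W2] properly contained in [W1].  Now [U1] meets [W1] trivially,
   while a complement of [W2] is eventually mapped into [A2]. *)
Lemma trapped_dim_ltn A1 A2 (x : V) (U1 : {vspace V}) :
  trapping A1 -> trapping A2 -> A1 `<=` A2 ->
  x != 0 -> A2 <[x]>%VS -> (forall j, ~ A1 <[iter_mx j *m x]>%VS) ->
  (forall v, v \in U1 -> v != 0 -> A1 <[v]>%VS) ->
  exists U2 : {vspace V}, (\dim U1 < \dim U2)%N /\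
    forall v, v \in U2 -> v != 0 -> A2 <[v]>%VS.
Proof.
move=> Atr1 Atr2 A12 x0 A2x A1x U1A.
have [W1 W1P] := escape_vspace Atr1; have [W2 W2P] := escape_vspace Atr2.
have W12 : (\dim W2 < \dim W1)%N.
  rewrite ltn_neqAle dimvS ?andbT.
    apply/eqP => dimE; have xW1 : x \in W1 by apply/W1P; right.
    have W21 : (W2 <= W1)%VS.
      apply/subvP => v /W2P[->|A2v]; first exact: mem0v.
      by apply/W1P; right=> j /A12; exact: A2v.
    have /eqP W21E : W2 == W1 by rewrite eqEdim W21 dimE leqnn.
    move: xW1; rewrite -W21E => /W2P[/eqP|/(_ 0%N)]; first by rewrite (negbTE x0).
    by rewrite mul1mx.
  apply/subvP => v /W2P[->|A2v]; first exact: mem0v.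
  by apply/W1P; right=> j /A12; exact: A2v.
have U1W1 : (\dim U1 + \dim W1 <= \dim {:V})%N.
  rewrite -dimv_disjoint_sum ?dimvS ?subvf//.
  apply/eqP; rewrite -subv0; apply/subvP => v /memv_capP[vU /W1P[->|A1v]].
    exact: mem0v.
  have [->|v0] := eqVneq v 0; first exact: mem0v.
  by have := U1A _ vU v0; have := A1v 0%N; rewrite mul1mx.
have [i iA] : exists i, forall v, v \in (W2^C)%VS -> v != 0 ->
    A2 <[iter_mx i *m v]>%VS.
  apply: eventually_absorbed => // v vC v0; apply: contrapT => nA.
  have vW2 : v \in W2 by apply/W2P; right=> j Aj; apply: nA; exists j.
  have : v \in (W2 :&: W2^C)%VS by rewrite memv_cap vW2.
  by rewrite capv_compl memv0 (negbTE v0).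
(* Being injective, [iter_mx i] preserves the dimension of the complement, so the image has
   codimension [\dim W2], while [U1] has codimension at least [\dim W1]. *)
pose f : 'End(V) := linfun (mulmx (iter_mx i)).
exists (f @: W2^C)%VS; split.
  rewrite limg_dim_eq; last first.
    apply/eqP; rewrite -subv0; apply/subvP => v /memv_capP[_].
    rewrite memv_ker lfunE/= memv0 => /eqP fv0; apply/negPn/negP => v0.
    by have := iter_mx_neq0 i v0; rewrite fv0 eqxx.
  have dC : (\dim W2 + \dim (W2^C)%VS)%N = \dim {:V}.
    by rewrite -(addv_complf W2) dimv_disjoint_sum// capv_compl.
  by rewrite -(ltn_add2l (\dim W2)) dC (leq_trans _ U1W1)// addnC ltn_add2l.
move=> w /memv_imgP[v vC ->]; rewrite lfunE/= => fv0; apply: iA => //.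
by apply: contraNneq fv0 => ->; rewrite mulmx0.
Qed.

End trapping_regions.

(** * Linear control flows *)

Section linear_flows.
Variables (R : realType) (n m : nat).
Local Notation V := 'cV[R]_n.+1.
Local Notation control := (R -> 'cV[R]_m).

Definition shift_control (s : R) (u : control) : control := fun t => u (s + t).

(** What the arguments on chains use of the differential equation: a linear cocycle over the shift
    of controls. The zero control, being shift invariant, yields an autonomous flow. *)
Definition linear_control_flow (U : set control)
    (phi : R -> V -> control -> V) : Prop :=
  [/\ U (fun=> 0), forall s u, U u -> U (shift_control s u),
      forall u t (c : R) x y, U u ->
        phi t (c *: x + y) u = c *: phi t x u + phi t y u,
      forall u x, U u -> phi 0 x u = x &
      forall u s t x, U u ->
        phi (s + t) x u = phi t (phi s x u) (shift_control s u)].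

Variables (N : V -> R) (U : set control) (phi : R -> V -> control -> V).
Hypotheses (N_norm : is_norm N) (phiP : linear_control_flow U phi).
Local Notation SS := (sphere_system N phi U).
Local Notation PS := (proj_system N phi U).
Local Notation e := (@euclid_norm R n).

Lemma flow_linear u t : U u -> linear (fun x => phi t x u).
Proof. by move=> Uu c x y; case: phiP => _ _ ->. Qed.

Lemma flow0 u t : U u -> phi t 0 u = 0.
Proof.
move=> Uu; have := flow_linear t Uu (-1) 0 0.
by rewrite scaler0 addr0 scaleN1r addNr.
Qed.

Lemma flowZ u t c x : U u -> phi t (c *: x) u = c *: phi t x u.
Proof. by move=> Uu; have := flow_linear t Uu c x 0; rewrite flow0// !addr0. Qed.

Lemma flowD u t x y : U u -> phi t (x + y) u = phi t x u + phi t y u.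
Proof. by move=> Uu; have := flow_linear t Uu 1 x y; rewrite !scale1r. Qed.

Lemma flowN u t x : U u -> phi t (- x) u = - phi t x u.
Proof. by move=> Uu; rewrite -scaleN1r flowZ// scaleN1r. Qed.

Lemma flow_neq0 u t x : U u -> x != 0 -> phi t x u != 0.
Proof.
case: phiP => _ Ushift _ phi0 phiD Uu; apply: contraNneq => phix.
have := phiD u t (- t) x Uu.
by rewrite subrr phi0// phix flow0 => [->//|]; exact: Ushift.
Qed.

Lemma flow_mx u t : U u -> exists F : 'M[R]_n.+1, forall x, phi t x u = F *m x.
Proof. by move=> Uu; exact/linear_mulmx/flow_linear. Qed.

Lemma to_sphere_flow u t x : U u -> x != 0 ->
  to_sphere (phi t (to_sphere x) u) = to_sphere (phi t x u).
Proof.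
by move=> Uu x0; rewrite flowZ// to_sphereZ// invr_gt0 euclid_norm_gt0.
Qed.

Lemma sphere_step eps T u t v w : U u -> T <= t -> v != 0 -> w != 0 ->
  N (to_sphere (phi t v u) - to_sphere w) < eps ->
  chain_step (S := SS) eps T (to_sphere v) (to_sphere w).
Proof.
move=> Uu Tt v0 w0 d; split; try exact: euclid_norm_to_sphere.
by exists u, t; split=> //; rewrite /= to_sphere_flow.
Qed.

Lemma sphere_stepN eps T s s' : chain_step (S := SS) eps T s s' ->
  chain_step (S := SS) eps T (- s) (- s').
Proof.
move=> [s1 s'1 [u [t [Uu Tt d]]]]; split; [exact: unit_sphereN..|].
exists u, t; split=> //=.
by rewrite flowN// to_sphereN -opprD (is_normN N_norm).
Qed.

Lemma sphere_chainN eps T s s' : controlled_chain (S := SS) eps T s s' ->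
  controlled_chain (S := SS) eps T (- s) (- s').
Proof.
apply: (controlled_chain_ind (S := SS)
  (Q := fun y : V => controlled_chain (S := SS) eps T (- s) (- y))).
  by move=> y /sphere_stepN/chain_step_chain.
move=> y z sy /sphere_stepN/chain_step_chain.
exact: controlled_chain_trans.
Qed.

Lemma sphere_chain_controllableN (s s' : V) : chain_controllable (S := SS) s s' ->
  chain_controllable (S := SS) (- s) (- s').
Proof. by move=> ss' eps T eps0 T0; apply/sphere_chainN/ss'. Qed.

(* Both halves apply the stability of positive combinations along the
   trajectory: backward in time to reach [x + y] from [E], forward in time to
   come back. *)
Lemma stays_inD E u x y : chain_control_set SS E -> U u ->
  stays_in phi E u x -> stays_in phi E u y ->
  (forall a b : R, [/\ 0 <= a, 0 <= b & 0 < a + b] -> a *: x + b *: y != 0) ->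
  stays_in phi E u (x + y).
Proof.
move=> EP Uu [x0 Ex] [y0 Ey] xy0.
have [_ Ushift _ _ phiD] := phiP; have [_ _ Etr _] := EP.
split=> [|t0]; first by have := xy0 1 1; rewrite !scale1r; apply; split.
have comb t a b : phi t (a *: x + b *: y) u = a *: phi t x u + b *: phi t y u.
  by rewrite flowD// !flowZ.
pose s : V := to_sphere (phi t0 x u).
rewrite (chain_control_setE EP (Ex t0)) -/s.
split=> eps T eps0 T0.
  (* Sampling backward in time: flowing for time [T] leads from index [j.+1] to [j], and the jump is
     made on arrival, so chain condition and distance refer to the same index. *)
  pose q (j : nat) : R := t0 - j%:R * T.
  have qS j : q j = q j.+1 + T by rewrite /q -addn1 natrD; ring.
  pose P j (a b : R) := controlled_chain (S := SS) eps T s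
    (to_sphere (a *: phi (q j) x u + b *: phi (q j) y u)).
  have P_step j (a b a' b' : R) : a *: x + b *: y != 0 ->
      a' *: x + b' *: y != 0 -> P j.+1 a b ->
      N (to_sphere (a *: phi (q j) x u + b *: phi (q j) y u) -
         to_sphere (a' *: phi (q j) x u + b' *: phi (q j) y u)) < eps ->
      P j a' b'.
    rewrite /P -!comb => ab ab' Pab d; apply: controlled_chain_trans Pab _.
    apply/chain_step_chain/(sphere_step (Ushift (q j.+1) _ Uu) (lexx T)) => //.
    - exact: flow_neq0.
    - exact: flow_neq0.
    - by rewrite -phiD// -qS.
  have qE : phi t0 (x + y) u = 1 *: phi (q 0%N) x u + 1 *: phi (q 0%N) y u.
    by rewrite !scale1r -flowD// /q mul0r subr0.
  rewrite qE; apply: (positive_combination_stable (P := P)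
    (x := fun j => phi (q j) x u) (y := fun j => phi (q j) y u)
    N_norm eps0) => //.
  - by move=> j a b ab; rewrite -comb flow_neq0// xy0.
  - move=> j a b ab Pab; apply: (P_step _ _ _ _ _ _ _ Pab); try exact: xy0.
    by rewrite subrr is_norm0.
  - by move=> a b ab Pab j a' b' ab' d; apply: P_step d; rewrite ?xy0.
  - by move=> j; rewrite /P scale1r scale0r addr0; exact: (Etr s _ (Ex t0) (Ex (q j))).
  - by move=> j; rewrite /P scale1r scale0r add0r; exact: (Etr s _ (Ex t0) (Ey (q j))).
pose q (j : nat) : R := t0 + j%:R * T.
have qS j : q j.+1 = q j + T by rewrite /q -addn1 natrD; ring.
pose P j (a b : R) := controlled_chain (S := SS) eps T
  (to_sphere (a *: phi (q j) x u + b *: phi (q j) y u)) s.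
have P_step j (a b a' b' : R) : a *: x + b *: y != 0 ->
    a' *: x + b' *: y != 0 -> P j.+1 a b ->
    N (to_sphere (a *: phi (q j.+1) x u + b *: phi (q j.+1) y u) -
       to_sphere (a' *: phi (q j.+1) x u + b' *: phi (q j.+1) y u)) < eps ->
    P j a' b'.
  rewrite /P -!comb => ab ab' Pab d; apply: controlled_chain_trans _ Pab.
  apply/chain_step_chain/(sphere_step (Ushift (q j) _ Uu) (lexx T)) => //.
  - exact: flow_neq0.
  - exact: flow_neq0.
  - by rewrite -phiD// -qS -(is_normN N_norm) opprB.
have qE : phi t0 (x + y) u = 1 *: phi (q 0%N) x u + 1 *: phi (q 0%N) y u.
  by rewrite !scale1r -flowD// /q mul0r addr0.
(* Forward in time the jump follows the flow from [q j] to [q j.+1], so the distance is measured one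
   index after the chain condition. *)
rewrite qE; apply: (positive_combination_stable (P := P)
    (x := fun j => phi (q j.+1) x u) (y := fun j => phi (q j.+1) y u)
    N_norm eps0) => //.
- by move=> j a b ab; rewrite -comb flow_neq0// xy0.
- move=> j a b ab Pab; apply: (P_step _ _ _ _ _ _ _ Pab); try exact: xy0.
  by rewrite subrr is_norm0.
- by move=> a b ab Pab j a' b' ab' d; apply: P_step d; rewrite ?xy0.
- by move=> j; rewrite /P scale1r scale0r addr0; exact: (Etr _ s (Ex (q j)) (Ex t0)).
- by move=> j; rewrite /P scale1r scale0r add0r; exact: (Etr _ s (Ey (q j)) (Ex t0)).
Qed.

Lemma stays_inZ E u c x : U u -> 0 < c -> stays_in phi E u x ->
  stays_in phi E u (c *: x).
Proof.
move=> Uu c0 [x0 Ex]; split; first by rewrite scaler_eq0 negb_or gt_eqF.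
by move=> t; rewrite flowZ// to_sphereZ.
Qed.

(** With [w] the direction of [F *m s], the correction [(s' - w) w^T F] turns this direction into
    [s']. At [v] it has size [e (s' - w) * |dot w (F *m v)|], which Cauchy-Schwarz bounds relative
    to [e (F *m v)]. *)
Lemma rank_one_perturbation (F : 'M[R]_n.+1) (s s' : V) (K delta : R) :
  (forall x, e x <= K * N x) -> 0 < K -> F *m s != 0 ->
  N (to_sphere (F *m s) - s') < delta ->
  exists M : 'M[R]_n.+1, M *m s = e (F *m s) *: s' /\
    forall v, e (M *m v - F *m v) <= K * delta * e (F *m v).
Proof.
move=> eK K0 Fs0 d; set w := to_sphere (F *m s).
have w1 : e w = 1 by exact: euclid_norm_to_sphere.
exists (F + (s' - w) *m (w^T *m F)).
have ME v : (F + (s' - w) *m (w^T *m F)) *m v =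
    F *m v + dot w (F *m v) *: (s' - w).
  rewrite mulmxDl -mulmxA -mulmxA; congr (_ + _).
  rewrite [w^T *m _](_ : _ = (dot w (F *m v))%:M) ?mul_mx_scalar//.
  apply/matrixP => i j; rewrite (ord1 i) (ord1 j) !mxE eqxx mulr1n.
  by apply: eq_bigr => k _; rewrite !mxE.
split=> [|v].
  rewrite ME -{1 2}(to_sphereK Fs0) -/w.
  have -> : dot w (e (F *m s) *: w) = e (F *m s).
    rewrite /dot; under eq_bigr do rewrite [(_ *: w) _ _]mxE mulrCA.
    by rewrite -mulr_sumr -euclid_norm_sqr w1 expr1n mulr1.
  by rewrite -scalerDr addrC subrK.
rewrite ME addrAC subrr add0r euclid_normZ.
have := norm_dot_le w (F *m v); rewrite w1 mul1r => dot_le.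
rewrite mulrC ler_pM ?euclid_norm_ge0//.
rewrite (le_trans (eK _))// ler_pM2l// ltW//.
by rewrite -(is_normN N_norm) opprB.
Qed.

Lemma proj_step eps T u t (v w : V) : U u -> T <= t -> v != 0 -> w != 0 ->
  N (to_sphere (phi t v u) - to_sphere w) < eps ->
  chain_step (S := PS) eps T <[v]>%VS <[w]>%VS.
Proof.
move=> Uu Tt v0 w0 d; split; try exact: proj_space_line.
exists u, t; split=> //=.
have phiv0 := flow_neq0 t Uu v0.
rewrite -(vline_to_sphere v0) -(vline_to_sphere w0) proj_flowE; last 2 first.
- by move=> c x; rewrite flowZ.
- exact: euclid_norm_to_sphere.
rewrite -(vline_to_sphere (flow_neq0 t Uu _)); last first.
  by rewrite unit_sphere_neq0//; exact: euclid_norm_to_sphere.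
rewrite proj_distE ?to_sphere_flow//; try exact: euclid_norm_to_sphere.
by rewrite gt_min d.
Qed.

Lemma proj_stepP eps T (s s' : V) : unit_sphere s -> unit_sphere s' ->
  chain_step (S := PS) eps T <[s]>%VS <[s']>%VS ->
  chain_step (S := SS) eps T s s' \/ chain_step (S := SS) eps T s (- s').
Proof.
move=> s1 s'1 [_ _ [u [t [Uu Tt]]]] /=.
have phis0 := flow_neq0 t Uu (unit_sphere_neq0 s1).
rewrite proj_flowE//; last by move=> c x; rewrite flowZ.
rewrite -(vline_to_sphere phis0) proj_distE//; last exact: euclid_norm_to_sphere.
rewrite gt_min => /orP[] d; [left|right]; split=> //; try by exists u, t.
exact: unit_sphereN.
Qed.

Lemma vline_mulmx (F : 'M[R]_n.+1) (v w : V) : v != 0 ->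
  (<[v]> = <[w]> -> <[F *m v]> = <[F *m w]>)%VS.
Proof.
move=> v0 vw; have /vlineP[c vE] : v \in <[w]>%VS by rewrite -vw memv_line.
rewrite vE -scalemxAr vlineZ//.
by apply: contraNneq v0 => c0; rewrite vE c0 scale0r.
Qed.

(* A fine enough chain from [L] to itself is the orbit of [L] under a periodic
   sequence of rank one perturbations of the flow, for which both regions are
   still trapping. *)
Lemma forward_closed_dim_ltn eps T (A1 A2 : set {vspace V}) (L U1 : {vspace V}) :
  0 < eps -> 0 < T ->
  forward_closed (S := PS) eps T A1 -> forward_closed (S := PS) eps T A2 ->
  A1 `<=` A2 -> chain_controllable (S := PS) L L -> A2 L -> ~ A1 L ->
  (forall v, v \in U1 -> v != 0 -> A1 <[v]>%VS) ->
  exists U2 : {vspace V}, (\dim U1 < \dim U2)%N /\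
    forall v, v \in U2 -> v != 0 -> A2 <[v]>%VS.
Proof.
move=> eps0 T0 A1cl A2cl A12 LL A2L A1L U1A.
have [K K0 NK] := to_sphere_lipschitz N_norm.
have [K' K'0 eK'] := euclid_le_is_norm N_norm.
(* The three bounds on [delta] serve, in order, to make the closed chain an [eps]-chain, to keep the
   perturbed maps injective, and to let the perturbation move directions by less than [eps / 2]. *)
have [delta [delta0 delta_eps K'delta KK'delta]] : exists delta,
    [/\ 0 < delta, delta <= eps, K' * delta < 1 & K * (K' * delta) < eps / 2].
  exists (Num.min eps (Num.min (K'^-1 / 2) (eps / (K * K') / 4))); split.
  - by rewrite !lt_min eps0 !divr_gt0 ?invr_gt0 ?mulr_gt0.
  - by rewrite ge_min lexx.
  - apply: (@le_lt_trans _ _ (K' * (K'^-1 / 2))).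
      by rewrite ler_pM2l// !ge_min lexx orbT.
    by rewrite mulrA divff ?gt_eqF// mul1r invf_lt1// ltr1n.
  - apply: (@le_lt_trans _ _ (K * (K' * (eps / (K * K') / 4)))).
      by rewrite !ler_pM2l// !ge_min lexx !orbT.
    have -> : K * (K' * (eps / (K * K') / 4)) = eps / 4.
      by field; rewrite !gt_eqF.
    by rewrite ltr_pM2l// ltf_pV2 ?posrE// ltr_nat.
have [k [xs [us [Ts [k0 x0 xk Sxs step]]]]] := LL delta T delta0 T0.
have xstep j : (j < k)%N -> chain_step (S := PS) delta T (xs j) (xs j.+1).
  by move=> jk; split; [exact/Sxs/ltnW|exact: Sxs|];
    exists (us j), (Ts j); exact: step.
(* A point of the chain inside [A1] would keep the rest of the chain inside, up to its endpoint
   [L]. *)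
have A1xs j : (j < k)%N -> ~ A1 (xs j).
  move=> jk A1j; apply: A1L; rewrite -xk -(subnKC (ltnW jk)).
  have : (j + (k - j) <= k)%N by rewrite subnKC// ltnW.
  elim: (k - j)%N => [|i IHi]; first by rewrite addn0.
  rewrite addnS => ik; apply: A1cl (IHi (ltnW ik)) _.
  have [? ? [u [t [Uu Tt d]]]] := xstep _ ik.
  by split=> //; exists u, t; split=> //; exact: lt_le_trans delta_eps.
pose good j (M : 'M[R]_n.+1) :=
    [/\ forall v : V, v != 0 -> M *m v != 0,
        forall A, forward_closed (S := PS) eps T A -> forall v w : V, v != 0 ->
          w != 0 -> A <[v]>%VS ->
          N (to_sphere (M *m v) - to_sphere w) < eps / 2 -> A <[w]>%VS &
        (<[M *m sphere_repr (xs j)]> = xs j.+1)%VS].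
have /choice[Gf GfP] : forall j, exists M, (j < k)%N -> good j M.
  move=> j; have [jk|_] := ltnP j k; last by exists 0.
  have [s1 sE] := sphere_reprP (Sxs _ (ltnW jk)).
  have [s'1 s'E] := sphere_reprP (Sxs _ jk).
  set s := sphere_repr (xs j) in s1 sE *; set s' := sphere_repr (xs j.+1) in s'1 s'E *.
  have := xstep _ jk; rewrite -sE -s'E => /(proj_stepP s1 s'1) sstep.
  (* Projective distance fixes [s'] only up to sign; [s''] is the representative near the image of
     [s]. *)
  have {sstep} [s'' [s''1 s''E [u [t [Uu Tt d]]]]] : exists s'' : V,
      [/\ unit_sphere s'', (<[s'']> = <[s']>)%VS & exists u t,
        [/\ U u, T <= t & N (to_sphere (phi t s u) - s'') < delta]].
    case: sstep => -[_ s''1 sstep]; [by exists s'|exists (- s')].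
    by split=> //; rewrite vlineN.
  have [F FE] := flow_mx t Uu; rewrite FE in d.
  have F0 (v : V) : v != 0 -> F *m v != 0 by move=> v0; rewrite -FE flow_neq0.
  have [M [Ms MF]] := rank_one_perturbation eK' K'0 (F0 _ (unit_sphere_neq0 s1)) d.
  have M0 (v : V) : v != 0 -> M *m v != 0.
    move=> v0; apply/eqP => Mv0; have := MF v.
    rewrite Mv0 sub0r euclid_normN leNgt => /negP; apply.
    by rewrite gtr_pMl// euclid_norm_gt0// F0.
  exists M => _; split=> //; last first.
    rewrite Ms vlineZ ?s''E//.
    exact/euclid_norm_neq0/F0/unit_sphere_neq0.
  move=> A Acl v w v0 w0 Av dw; apply: (Acl _ _ Av).
  apply: (proj_step Uu Tt) => //; rewrite FE.
  have -> : to_sphere (F *m v) - to_sphere w =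
      (to_sphere (F *m v) - to_sphere (M *m v)) + (to_sphere (M *m v) - to_sphere w).
    by rewrite addrA subrK.
  case: (N_norm) => _ _ ND; apply: le_lt_trans (ND _ _) _.
  rewrite [ltRHS](splitr eps) ltrD//.
  rewrite -(is_normN N_norm) opprB.
  apply: le_lt_trans (NK _ _ (M0 _ v0) (F0 _ v0)) _.
  apply: le_lt_trans KK'delta; rewrite ler_pM2l// ler_pdivrMr//.
  by rewrite euclid_norm_gt0// F0.
(* Escape concerns all times, hence the infinite repetition; it closes up because the chain ends at
   its starting line. *)
pose G j := Gf (j %% k)%N.
have GP j := GfP (j %% k)%N (ltn_pmod j k0).
have [s1 sE] := sphere_reprP (Sxs 0%N (leq0n k)).
set s := sphere_repr (xs 0%N) in s1 sE *.
have s0 := unit_sphere_neq0 s1.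
have G0 j (v : V) : v != 0 -> G j *m v != 0 by case: (GP j) => + _ _; apply.
have orbit j : (<[iter_mx G j *m s]> = xs (j %% k)%N)%VS.
  elim: j => [|j IHj]; first by rewrite mul1mx mod0n.
  rewrite iter_mxS; have [_ _] := GP j.
  have [_ reprE] := sphere_reprP (Sxs _ (ltnW (ltn_pmod j k0))).
  rewrite (vline_mulmx _ (iter_mx_neq0 G0 j s0) (etrans IHj (esym reprE))) => ->.
  have -> : (j.+1 %% k = (j %% k).+1 %% k)%N by rewrite -addn1 -modnDml addn1.
  have := ltn_pmod j k0; rewrite leq_eqVlt => /predU1P[->|/modn_small -> //].
  by rewrite modnn xk x0.
apply: (@trapped_dim_ltn _ _ N (eps / 2) G N_norm _ G0 A1 A2 s) => //.
- exact: divr_gt0.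
- by move=> j v w v0 w0 Av; case: (GP j) => _ + _; apply.
- by move=> j v w v0 w0 Av; case: (GP j) => _ + _; apply.
- by rewrite sE x0.
- by move=> j; rewrite orbit; apply: A1xs; exact: ltn_pmod.
Qed.

(* The points are added in an order such that each one is unreachable from the
   previous ones. *)
Lemma reach_dim_ge eps T (r : seq {vspace V}) : 0 < eps -> 0 < T ->
  uniq r -> {in r, forall L, chain_controllable (S := PS) L L} ->
  {in r &, forall L L', L != L' -> ~ (controlled_chain (S := PS) eps T L L' /\
    controlled_chain (S := PS) eps T L' L)} ->
  exists W : {vspace V}, (size r <= \dim W)%N /\
    forall v, v \in W -> v != 0 -> exists2 L, L \in r &
      controlled_chain (S := PS) eps T L <[v]>%VS.
Proof.
move=> eps0 T0; have [k] := ubnP (size r); elim: k r => // k IHk r.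
rewrite ltnS => rk ur rcc rinj.
have [->|r0] := eqVneq r [::].
  exists 0%VS; rewrite leq0n; split=> // v; rewrite memv0 => /eqP ->.
  by rewrite eqxx.
pose reach L : pred {vspace V} := fun L' => `[< controlled_chain (S := PS) eps T L L' >].
(* [L] reaches as many points of [r] as possible. A different [L'] reaching [L] would reach all of
   these and also itself, which [L] does not reach. *)
have [L Lr Lsource] : exists2 L, L \in r & forall L', L' \in r -> L' != L ->
    ~ controlled_chain (S := PS) eps T L' L.
  pose Q c := has (fun L => count (reach L) r == c) r.
  have exQ : exists c, Q c.
    case: r r0 @Q {ur rcc rinj rk} => // L r _ Q; exists (count (reach L) (L :: r)).
    by apply/hasP; exists L; rewrite ?mem_head.
  have Q_le c : Q c -> (c <= size r)%N.
    by move=> /hasP[L _ /eqP <-]; exact: count_size.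
  have [c /hasP[L Lr /eqP Lc] c_max] := ex_maxnP exQ Q_le.
  exists L => // L' L'r L'L L'toL.
  have : Q (count (reach L') r) by apply/hasP; exists L'.
  move=> /c_max; rewrite leqNgt => /negP; apply.
  rewrite -Lc; have := count_predUI (reach L) (pred1 L') r.
  have -> : count (predI (reach L) (pred1 L')) r = 0%N.
    apply/eqP; rewrite -leqn0 leqNgt -has_count; apply/hasPn => M Mr /=.
    apply/negP => /andP[/asboolP LM /eqP ME]; rewrite ME in LM.
    exact: (rinj _ _ L'r Lr L'L).
  rewrite addn0 (count_uniq_mem _ ur) L'r addn1 => <-.
  apply: sub_count => M /= /orP[/asboolP LM|/eqP ->]; apply/asboolP.
    exact: controlled_chain_trans L'toL LM.
  exact: rcc.
have szr : size (rem L r) = (size r).-1 by rewrite size_rem.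
have szr0 : (0 < size r)%N by rewrite lt0n size_eq0.
have sub_rem : {subset rem L r <= r} by move=> M /mem_rem.
have [||M /sub_rem /rcc//|M M' /sub_rem Mr /sub_rem M'r|W1 [W1r W1P]] := IHk (rem L r).
- by rewrite szr prednK.
- exact: rem_uniq.
- exact: rinj.
pose A (q : seq {vspace V}) : set {vspace V} :=
  [set M | exists2 L, L \in q & controlled_chain (S := PS) eps T L M].
have A_closed q : forward_closed (S := PS) eps T (A q).
  move=> M M' [L0 L0q L0M] /chain_step_chain MM'; exists L0 => //.
  exact: controlled_chain_trans MM'.
have [||||//|W2 [W12 W2P]] := @forward_closed_dim_ltn eps T
    (A (rem L r)) (A r) L W1 eps0 T0 (A_closed _) (A_closed _).
- by move=> M [L0 /sub_rem L0r L0M]; exists L0.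
- exact: rcc.
- by exists L => //; exact: rcc.
- move=> [L' L'r]; have := L'r; rewrite mem_rem_uniq// inE => /andP[L'L L'r'].
  exact: Lsource.
by exists W2; split=> //; rewrite -(prednK szr0) -szr (leq_ltn_trans W1r).
Qed.

Lemma proj_chain_control_sets_bound (k : nat) (PE : nat -> set {vspace V}) :
  (forall i, (i < k)%N -> chain_control_set PS (PE i)) ->
  (forall i j, (i < k)%N -> (j < k)%N -> PE i = PE j -> i = j) ->
  (k <= n.+1)%N.
Proof.
move=> PEcc PEinj.
have /choice[x xP] : forall i, exists L, (i < k)%N -> PE i L.
  move=> i; have [ik|_] := ltnP i k; last by exists 0%VS.
  by have [[L PEL] _ _ _] := PEcc i ik; exists L.
have xcc i : (i < k)%N -> chain_controllable (S := PS) (x i) (x i).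
  by move=> ik; have [_ _ Etr _] := PEcc i ik; apply: Etr; exact: xP.
have x_inj i j : (i < k)%N -> (j < k)%N ->
    chain_controllable (S := PS) (x i) (x j) ->
    chain_controllable (S := PS) (x j) (x i) -> i = j.
  move=> ik jk ij ji; apply: PEinj => //.
  rewrite (chain_control_setE (PEcc i ik) (xP i ik)).
  apply/esym/(chain_control_setE (PEcc j jk)).
  by rewrite (chain_control_setE (PEcc j jk) (xP j jk)).
pose sep eps T i j := ~ (controlled_chain (S := PS) eps T (x i) (x j) /\
  controlled_chain (S := PS) eps T (x j) (x i)).
(* Each pair has its own separating constants; the least [eps] and the largest [T] over the finite
   list of pairs separate all of them. *)
have [eps [T [eps0 T0 sepP]]] : exists eps T, [/\ 0 < eps, 0 < T &
    forall p, p \in [seq (i, j) | i <- iota 0 k, j <- iota 0 k] -> p.1 != p.2 ->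
      sep eps T p.1 p.2].
  have : forall p, p \in [seq (i, j) | i <- iota 0 k, j <- iota 0 k] ->
      (p.1 < k)%N /\ (p.2 < k)%N.
    move=> p /allpairsP[[i j] /= [ik jk ->]] /=.
    by move: ik jk; rewrite !mem_iota !add0n.
  elim: [seq _ | _ <- _, _ <- _] => [|p r IHr] rk.
    by exists 1, 1; split.
  have [|eps [T [eps0 T0 sepr]]] := IHr.
    by move=> q qr; apply: rk; rewrite in_cons qr orbT.
  have [pE|p12] := eqVneq p.1 p.2.
    exists eps, T; split=> // q; rewrite in_cons => /predU1P[->|/sepr//].
    by rewrite pE eqxx.
  have [pk1 pk2] := rk p (mem_head _ _).
  have [eps' [T' [eps'0 T'0 sepp]]] : exists eps' T',
      [/\ 0 < eps', 0 < T' & sep eps' T' p.1 p.2].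
    have [/not_chain_controllable|] :
        ~ chain_controllable (S := PS) (x p.1) (x p.2) \/
        ~ chain_controllable (S := PS) (x p.2) (x p.1).
    - apply/not_andP => -[ij ji]; move/eqP: p12; apply; exact: x_inj.
    - by move=> [e' [T' [e0 T'0 nc]]]; exists e', T'; split=> // -[].
    - move=> /not_chain_controllable[e' [T' [e0 T'0 nc]]].
      by exists e', T'; split=> // -[].
  exists (Num.min eps eps'), (Num.max T T'); split.
  - by rewrite lt_min eps0.
  - by rewrite lt_max T0.
  move=> q; rewrite in_cons => /predU1P[->|qr] q12 [ij ji].
    by apply: sepp; split; [move: ij|move: ji]; apply: le_controlled_chain;
      rewrite ?ge_min ?le_max lexx orbT.
  by apply: (sepr _ qr q12); split; [move: ij|move: ji];
    apply: le_controlled_chain; rewrite ?ge_min ?le_max lexx.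
have sep_ij i j : (i < k)%N -> (j < k)%N -> i != j -> sep eps T i j.
  move=> ik jk; apply: (sepP (i, j)); apply/allpairsP; exists (i, j).
  by rewrite !mem_iota !add0n.
pose r := [seq x i | i <- iota 0 k].
have rP L : L \in r -> exists2 i, (i < k)%N & L = x i.
  by move=> /mapP[i]; rewrite mem_iota add0n => /andP[_ ik] ->; exists i.
have [||L L' /rP[i ik ->] /rP[j jk ->]|W [rW _]] :=
    @reach_dim_ge eps T r eps0 T0.
- rewrite map_inj_in_uniq ?iota_uniq// => i j.
  rewrite !mem_iota !add0n => /andP[_ ik] /andP[_ jk] xij.
  by apply: x_inj; rewrite // ?xij//; [rewrite -xij|]; exact: xcc.
- by move=> L /rP[i ik ->]; exact: xcc.
- by move=> xij; apply: sep_ij => //; apply: contraNneq xij => ->.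
move: rW; rewrite size_map size_iota => /leq_trans; apply.
by rewrite (leq_trans (dimvS (subvf W)))// dimvf dim_matrix mulr1.
Qed.

(** * Chains on the sphere and on projective space *)

Lemma sphere_chain_proj eps T (s s' : V) :
  controlled_chain (S := SS) eps T s s' ->
  controlled_chain (S := PS) eps T <[s]>%VS <[s']>%VS.
Proof.
have step (v w : V) : chain_step (S := SS) eps T v w ->
    controlled_chain (S := PS) eps T <[v]>%VS <[w]>%VS.
  move=> [v1 w1 [u [t [Uu Tt d]]]].
  apply/chain_step_chain/(proj_step Uu Tt); try exact: unit_sphere_neq0.
  by rewrite (to_sphere_id w1).
apply: (controlled_chain_ind (S := SS)
  (Q := fun w : V => controlled_chain (S := PS) eps T <[s]>%VS <[w]>%VS)).
  by move=> w; exact: step.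
by move=> v w sv /step; exact: controlled_chain_trans.
Qed.

(** Every step lifts up to the sign of its endpoint; when the sign is wrong, the next step is
    replaced by its antipode. *)
Lemma proj_chain_lift eps T (s s' : V) : unit_sphere s -> unit_sphere s' ->
  controlled_chain (S := PS) eps T <[s]>%VS <[s']>%VS ->
  controlled_chain (S := SS) eps T s s' \/
  controlled_chain (S := SS) eps T s (- s').
Proof.
move=> s1 s'1 ss'.
suff : forall L, controlled_chain (S := PS) eps T <[s]>%VS L -> forall w : V,
    L = <[w]>%VS -> unit_sphere w ->
    controlled_chain (S := SS) eps T s w \/
    controlled_chain (S := SS) eps T s (- w).
  by move=> /(_ _ ss' s'); exact.
apply: (controlled_chain_ind (S := PS) (Q := fun L => forall w : V,
  L = <[w]>%VS -> unit_sphere w ->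
  controlled_chain (S := SS) eps T s w \/
  controlled_chain (S := SS) eps T s (- w))).
  move=> L + w LE w1; rewrite LE => /(proj_stepP s1 w1).
  by case=> /chain_step_chain; [left|right].
move=> L L' QL LL' w L'E w1; have [/sphere_reprP[v1 vE] _ _] := LL'.
set v := sphere_repr L in v1 vE.
move: LL'; rewrite L'E -vE => /(proj_stepP v1 w1) vw.
have {}vw : controlled_chain (S := SS) eps T v w \/
    controlled_chain (S := SS) eps T v (- w).
  by case: vw => /chain_step_chain; [left|right].
have [sv|sv] := QL v (esym vE) v1.
  by case: vw => /(controlled_chain_trans sv); [left|right].
case: vw => /sphere_chainN/(controlled_chain_trans sv); first by right.
by rewrite opprK; left.
Qed.

Lemma chain_controllable_proj (s s' : V) :
  chain_controllable (S := SS) s s' ->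
  chain_controllable (S := PS) <[s]>%VS <[s']>%VS.
Proof. by move=> ss' eps T eps0 T0; apply/sphere_chain_proj/ss'. Qed.

(** The sign of a lifted chain may vary with the constants. If each sign failed for some constants,
    both would fail for the smaller [eps] and the larger [T]. *)
Lemma chain_controllable_lift (s s' : V) : unit_sphere s -> unit_sphere s' ->
  chain_controllable (S := PS) <[s]>%VS <[s']>%VS ->
  chain_controllable (S := SS) s s' \/ chain_controllable (S := SS) s (- s').
Proof.
move=> s1 s'1 ss'; apply: contrapT => /not_orP[].
move=> /not_chain_controllable[e1 [T1 [e10 T10 n1]]].
move=> /not_chain_controllable[e2 [T2 [e20 T20 n2]]].
have := ss' (Num.min e1 e2) (Num.max T1 T2).
rewrite lt_min e10 lt_max T10 => /(_ e20 isT)/(proj_chain_lift s1 s'1)[] c.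
  by apply: n1; move: c; apply: le_controlled_chain;
    rewrite ?ge_min ?le_max lexx.
by apply: n2; move: c; apply: le_controlled_chain;
  rewrite ?ge_min ?le_max lexx orbT.
Qed.

(** * The preimage of a projective chain control set on the sphere *)

Section chain_control_set_lift.
Variable PE : set {vspace V}.
Hypothesis PEcc : chain_control_set PS PE.
Local Notation SE0 := (sphere_lift PE).

Lemma sphere_liftN (s : V) : SE0 s -> SE0 (- s).
Proof. by move=> [s1 Ps]; split; rewrite ?vlineN//; exact: unit_sphereN. Qed.

Lemma sphere_lift_nonempty : SE0 !=set0.
Proof.
have [[L PL] PE_space _ _] := PEcc.
have [s1 sE] := sphere_reprP (PE_space _ PL).
by exists (sphere_repr L); split=> //; rewrite sE.
Qed.

Lemma sphere_lift_controllable (s s' : V) : SE0 s -> SE0 s' ->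
  chain_controllable (S := SS) s s' \/ chain_controllable (S := SS) s (- s').
Proof.
have [_ _ Ptr _] := PEcc; move=> [s1 Ps] [s'1 Ps'].
exact: chain_controllable_lift (Ptr _ _ Ps Ps').
Qed.

Lemma chain_transitive_sub_lift (F : set V) (s : V) : F `<=` @unit_sphere R n ->
  chain_transitive (S := SS) F -> F s -> SE0 s -> F `<=` SE0.
Proof.
move=> F1 Ftr Fs [_ Ps] w Fw; split; first exact: F1.
rewrite (chain_control_setE PEcc Ps).
by split; apply: chain_controllable_proj; exact: Ftr.
Qed.

(** By symmetry [s0] and [- s0] reach each other, so a wrong sign of a lifted chain is corrected by
    passing through both. *)
Lemma sphere_lift_chain_control_set (s0 : V) : SE0 s0 ->
  chain_controllable (S := SS) s0 (- s0) -> chain_control_set SS SE0.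
Proof.
move=> s0E s0N; have s0N' := sphere_chain_controllableN s0N.
rewrite opprK in s0N'.
have to_s0 (s : V) : SE0 s -> chain_controllable (S := SS) s s0.
  move=> /sphere_lift_controllable/(_ s0E)[//|ss0].
  exact: chain_controllable_trans ss0 s0N'.
have from_s0 (s : V) : SE0 s -> chain_controllable (S := SS) s0 s.
  move=> /(sphere_lift_controllable s0E)[//|/sphere_chain_controllableN].
  by rewrite opprK; exact: chain_controllable_trans.
split; [exact: sphere_lift_nonempty|by move=> s []| |].
  by move=> s s' /to_s0 ss0 /from_s0; exact: chain_controllable_trans.
move=> F F1 Ftr EF; apply/seteqP; split=> //.
by apply: (chain_transitive_sub_lift F1 Ftr (EF _ s0E)).
Qed.

Lemma sphere_lift_unique (F : set V) :
  chain_control_set SS SE0 -> chain_control_set SS F ->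
  (forall s, F s -> PE <[s]>%VS) -> F = SE0.
Proof.
move=> [_ SE1 SEtr _] [_ F1 _ Fmax] FP; apply/esym/Fmax => // s Fs.
by split; [exact: F1|exact: FP].
Qed.

Lemma sphere_lift_chain_control_setP : chain_control_set SS SE0 <->
  exists s0 : V, [/\ unit_sphere s0, PE <[s0]>%VS & chain_reachable SS s0 (- s0)].
Proof.
split=> [[[s sE] _ SEtr _]|[s0 [s1 Ps s0N]]]; last first.
  exact: (@sphere_lift_chain_control_set s0).
by exists s; split; [case: sE..|apply: SEtr => //; exact: sphere_liftN].
Qed.

(** The sign with which [s0] reaches [s] equals the sign with which [s] reaches [s0], as otherwise
    one of them would reach its antipode. This common sign decides the class of [s]. *)
Lemma sphere_lift_split (s0 : V) : SE0 s0 ->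
  (forall s : V, SE0 s -> ~ chain_controllable (S := SS) s (- s)) ->
  let SE1 := chain_class (S := SS) s0 in
  let SE2 := chain_class (S := SS) (- s0) in
  [/\ chain_control_set SS SE1, chain_control_set SS SE2, SE1 <> SE2,
      SE1 = [set - s | s in SE2] & SE1 `|` SE2 = SE0].
Proof.
move=> s0E nN SE1 SE2.
have N_cc (s s' : V) : chain_controllable (S := SS) (- s) (- s') ->
    chain_controllable (S := SS) s s'.
  by move=> /sphere_chain_controllableN; rewrite !opprK.
have refl (s : V) : SE0 s -> chain_controllable (S := SS) s s.
  by move=> sE; have [//|/(nN s sE)] := sphere_lift_controllable sE sE.
have ccN (s s' : V) : chain_controllable (S := SS) s (- s') ->
    chain_controllable (S := SS) (- s) s'.
  by move=> /sphere_chain_controllableN; rewrite opprK.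
have s0NE := sphere_liftN s0E.
have class_lift (s : V) : SE0 s -> chain_class (S := SS) s `<=` SE0.
  move=> sE; have [_ C1 Ctr _] := chain_control_set_class (refl s sE).
  apply: (@chain_transitive_sub_lift _ s) => //.
  by split; exact: refl.
split; [exact/chain_control_set_class/refl..| | |].
- move=> SE12; have : SE2 s0 by rewrite -SE12; split; exact: refl.
  by move=> [_ s0N]; apply: (nN s0 s0E).
- apply/seteqP; split=> [s [s0s ss0]|_ [s [s0s ss0] <-]].
    by exists (- s); rewrite ?opprK//; split; exact: sphere_chain_controllableN.
  by split; apply: N_cc; rewrite opprK.
- apply/seteqP; split=> [s [|]|s sE]; [exact: class_lift..|].
  have [s0s|s0s] := sphere_lift_controllable s0E sE.
    have [ss0|ss0] := sphere_lift_controllable sE s0E; first by left.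
    by case: (nN s0 s0E); exact: chain_controllable_trans s0s ss0.
  have [ss0|ss0] := sphere_lift_controllable sE s0E.
    case: (nN s sE); exact: chain_controllable_trans ss0 s0s.
  by right; split=> //; exact: ccN.
Qed.

Lemma sphere_lift_splitP :
  (exists SE1 SE2 : set V, [/\ chain_control_set SS SE1,
      chain_control_set SS SE2, SE1 <> SE2, SE1 = [set - s | s in SE2] &
      SE1 `|` SE2 = SE0]) <->
  (forall s0 : V, unit_sphere s0 -> PE <[s0]>%VS ->
     ~ chain_reachable SS s0 (- s0)).
Proof.
split=> [[SE1 [SE2 [E1 E2 E12 _ E0]]] s0 s1 Ps s0N|nN]; last first.
  have [s0 s0E] := sphere_lift_nonempty.
  exists (chain_class (S := SS) s0), (chain_class (S := SS) (- s0)).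
  by apply: sphere_lift_split => // s [s1 Ps]; exact: nN.
(* One point reaching its antipode makes the whole preimage chain transitive; it contains both sets,
   so by maximality both equal it. *)
have [_ E01 E0tr _] : chain_control_set SS SE0.
  by apply/sphere_lift_chain_control_setP; exists s0.
have [_ _ _ max1] := E1; have [_ _ _ max2] := E2.
have e1 : SE0 = SE1 by apply: max1 => //; rewrite -E0 => s; left.
have e2 : SE0 = SE2 by apply: max2 => //; rewrite -E0 => s; right.
by apply: E12; rewrite -e1 -[RHS]e2.
Qed.

Lemma stays_in_lift_vspace u : U u -> chain_control_set SS SE0 ->
  exists W : {vspace V}, stays_in phi SE0 u `|` [set 0] = [set x | x \in W].
Proof.
move=> Uu SE0cc.
have [||x y + + xy0|W WP] := @vspace_of_cone R n (stays_in phi SE0 u `|` [set 0]).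
- by right.
- move=> c x c0 [[x0 Ex]|->]; last by right; rewrite scaler0.
  left; split=> [|t]; first by rewrite scaler_eq0 negb_or c0.
  rewrite flowZ//; have [c_lt0|c_gt0|/eqP] := ltgtP c 0; last by rewrite (negbTE c0).
    rewrite -(opprK c) scaleNr to_sphereN to_sphereZ ?oppr_gt0//.
    exact: sphere_liftN.
  by rewrite to_sphereZ.
- have x0 : x != 0 by have := xy0 1 0; rewrite scale1r scale0r addr0 addr0; apply.
  have y0 : y != 0 by have := xy0 0 1; rewrite scale1r scale0r !add0r; apply.
  move=> [Ex|/eqP]; last by rewrite (negbTE x0).
  move=> [Ey|/eqP]; last by rewrite (negbTE y0).
  by left; exact: stays_inD.
by exists W; apply/seteqP; split=> x /WP.
Qed.

(** A vanishing nonnegative combination would make [x1] and [x2] opposite in direction, so at time 0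
    the set [E] would contain antipodal points. *)
Lemma stays_in_convex_cone (E : set V) u (x1 x2 : V) (alpha beta : R) :
  chain_control_set SS E -> E `<=` SE0 ->
  (forall s : V, SE0 s -> ~ chain_controllable (S := SS) s (- s)) ->
  U u -> stays_in phi E u x1 -> stays_in phi E u x2 ->
  0 < alpha -> 0 < beta -> stays_in phi E u (alpha *: x1 + beta *: x2).
Proof.
move=> Ecc E0 nN Uu Ex1 Ex2 al be.
have [x10 E1] := Ex1; have [x20 E2] := Ex2; have [_ _ Etr _] := Ecc.
have [_ _ _ phi0 _] := phiP.
apply: stays_inD => //; [exact: stays_inZ..|move=> a b [a0 b0 ab]].
rewrite !scalerA; apply/eqP => x12.
move: a0; rewrite le_eqVlt => /predU1P[a0|a0].
  move: x12; rewrite -a0 mul0r scale0r add0r => /eqP.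
  by rewrite scaler_eq0 (negbTE x20) orbF gt_eqF// mulr_gt0//; rewrite -a0 add0r in ab.
move: b0; rewrite le_eqVlt => /predU1P[b0|b0].
  move: x12; rewrite -b0 mul0r scale0r addr0 => /eqP.
  by rewrite scaler_eq0 (negbTE x10) orbF gt_eqF// mulr_gt0.
have {}E1 := E1 0; have {}E2 := E2 0; rewrite !phi0// in E1 E2.
apply: (nN _ (E0 _ E1)).
suff <- : to_sphere x2 = - to_sphere x1 by exact: Etr.
rewrite -(to_sphereZ x2 (mulr_gt0 b0 be)) -(to_sphereZ x1 (mulr_gt0 a0 al)).
by rewrite -to_sphereN; congr to_sphere; apply/eqP; rewrite -addr_eq0 addrC x12.
Qed.

End chain_control_set_lift.

(** * Existence and number of chain control sets on the sphere *)

Lemma exists_chain_recurrent : exists s : V, chain_controllable (S := SS) s s.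
Proof.
have [U0 _ _ _ phiD] := phiP.
pose u0 : control := fun=> 0.
have {}phiD (s t : R) x : phi (s + t) x u0 = phi t (phi s x u0) u0.
  exact: phiD.
have c0 : (const_mx 1 : V) != 0.
  by apply/eqP => /matrixP/(_ 0 0)/eqP; rewrite !mxE oner_eq0.
pose x (k : nat) : V := phi k%:R (const_mx 1) u0.
have x0 k : x k != 0 by exact: flow_neq0.
have xD (k t : nat) : x (k + t)%N = phi t%:R (x k) u0.
  by rewrite /x natrD phiD.
(* The recurrent point is a limit point of a normalised orbit under the zero control, sampled at
   integer times. *)
have [s [s1 s_clus]] : (@unit_sphere R n `&`
    cluster ((fun k => to_sphere (x k)) @ \oo)) !=set0.
  apply: compact_unit_sphere; exists 0%N => // k _.
  exact: euclid_norm_to_sphere.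
have s_freq r k0 : 0 < r -> exists2 k, (k0 <= k)%N & e (to_sphere (x k) - s) < r.
  move=> r0.
  have [||v [[k /= k0k <-] /= vs]] := s_clus
      [set to_sphere (x k) | k in [set k | (k0 <= k)%N]]
      [set v | `|s - v| < r / n.+1%:R].
  - by exists k0 => // k k0k; exists k.
  - have /cvgrPdist_lt := @cvg_id _ (nbhs s); apply; exact: divr_gt0.
  - exists k => //; apply: le_lt_trans (euclid_le_mx_norm _) _.
    by rewrite distrC mulrC -ltr_pdivlMr.
exists s => eps T eps0 T0.
have s0 := unit_sphere_neq0 s1.
have [K K0 NK] := to_sphere_lipschitz N_norm.
have [K' K'0 NK'] := is_norm_le_euclid N_norm.
pose tau := Num.bound T.
have Ttau : T <= tau%:R by apply/ltW/archi_boundP/ltW.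
have [F FE] := flow_mx tau%:R U0; have [C C0 FC] := mulmx_bounded F.
have Fs0 : 0 < e (F *m s) by rewrite -FE euclid_norm_gt0// flow_neq0.
have [k _ ks] : exists2 k, (0 <= k)%N &
    e (to_sphere (x k) - s) < eps * e (F *m s) / (K * C).
  by apply: s_freq; rewrite divr_gt0 ?mulr_gt0.
have [l kl ls] := s_freq (eps / K') (k + tau + tau)%N (divr_gt0 eps0 K'0).
(* From [s], which is close to the orbit at time [k], the flow for time [tau] followed by a jump
   lands on the orbit at [k + tau]. The second step follows the orbit to its return near [s] at time
   [l], at least [tau] later. *)
apply: (@controlled_chain_trans _ _ SS _ _ _ (to_sphere (x (k + tau)%N))).
  rewrite -{1}(to_sphere_id s1).
  apply/chain_step_chain/(sphere_step U0 Ttau) => //.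
  rewrite xD -(to_sphere_flow _ U0 (x0 k)) !FE -(is_normN N_norm) opprB.
  have Fx0 : F *m to_sphere (x k) != 0.
    by rewrite -FE flow_neq0// unit_sphere_neq0//; exact: euclid_norm_to_sphere.
  apply: le_lt_trans (NK _ _ Fx0 _) _; first by rewrite -FE flow_neq0.
  rewrite mulrA ltr_pdivrMr// -mulmxBr.
  apply: (@le_lt_trans _ _ (K * C * e (to_sphere (x k) - s))).
    by rewrite -mulrA ler_pM2l.
  by rewrite mulrC -ltr_pdivlMr// mulr_gt0.
rewrite -(to_sphere_id s1).
have Tl : T <= (l - (k + tau))%:R.
  by apply: le_trans Ttau _; rewrite ler_nat leq_subRL ?(leq_trans _ kl)// leq_addr.
apply/chain_step_chain/(sphere_step U0 Tl) => //.
rewrite -xD subnKC; last by rewrite (leq_trans _ kl)// leq_addr.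
rewrite (to_sphere_id s1).
by apply: le_lt_trans (NK' _) _; rewrite mulrC -ltr_pdivlMr.
Qed.

(** When the two signs differ, a path through the antipodes restores the missing direction, for
    instance from [s0] to [- s], to [- s0], to [s]. *)
Lemma sphere_lift_class (PE : set {vspace V}) (s0 s : V) :
  chain_control_set PS PE -> sphere_lift PE s0 -> sphere_lift PE s ->
  chain_class (S := SS) s = chain_class (S := SS) s0 \/
  chain_class (S := SS) s = chain_class (S := SS) (- s0).
Proof.
move=> PEcc s0E sE.
have class_eq (v w : V) : chain_controllable (S := SS) v w ->
    chain_controllable (S := SS) w v ->
    chain_class (S := SS) v = chain_class (S := SS) w.
  move=> vw wv; apply: (@chain_control_setE _ _ SS) => //.
  by apply: chain_control_set_class; exact: chain_controllable_trans vw wv.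
have ccN (v w : V) : chain_controllable (S := SS) v (- w) ->
    chain_controllable (S := SS) (- v) w.
  by move=> /sphere_chain_controllableN; rewrite opprK.
have [ss0|ss0] := sphere_lift_controllable PEcc sE s0E;
have [s0s|s0s] := sphere_lift_controllable PEcc s0E sE.
- by left; exact: class_eq.
- left; apply: class_eq => //; apply: (chain_controllable_trans s0s).
  apply: (chain_controllable_trans (sphere_chain_controllableN ss0)).
  exact: ccN.
- left; apply: class_eq => //; apply: (chain_controllable_trans ss0).
  apply: (chain_controllable_trans (sphere_chain_controllableN s0s)).
  exact: ccN.
- by right; apply: class_eq => //; exact: ccN.
Qed.

Lemma chain_control_sets_count : exists l l1 : nat,
  [/\ ([set PE | chain_control_set PS PE] #= `I_l)%card,
      ([set SE | chain_control_set SS SE] #= `I_l1)%card,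
      (1 <= l1)%N, (l1 <= 2 * l)%N & (2 * l <= 2 * n.+1)%N].
Proof.
have [|l ln PSl] := @card_eq_II_bound _ [set PE | chain_control_set PS PE] n.+1.
  exact: proj_chain_control_sets_bound.
move: (PSl); rewrite card_eq_sym => /card_set_bijP[h [hP h_inj h_surj]].
have /choice[c cP] : forall i, exists s, (i < l)%N -> sphere_lift (h i) s.
  move=> i; have [il|_] := ltnP i l; last by exists 0.
  by have [s sE] := sphere_lift_nonempty (hP i il); exists s.
(* A chain control set on the sphere is determined by the projective one below it and a sign; these
   labels give the factor 2. *)
have SS_class SE : chain_control_set SS SE -> exists p : 'I_l * bool,
    SE = chain_class (S := SS) (if p.2 then - c p.1 else c p.1).
  move=> SEcc; have [[s sSE] SE1 SEtr _] := SEcc.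
  have ss := SEtr _ _ sSE sSE.
  have PEcc := chain_control_set_class (chain_controllable_proj ss).
  have [i il hi] := h_surj _ PEcc.
  have sE : sphere_lift (h i) s.
    by rewrite hi; split; [exact: SE1|split; exact: chain_controllable_proj].
  rewrite (chain_control_setE SEcc sSE).
  have [->|->] := sphere_lift_class (hP i il) (cP i il) sE.
    by exists (Ordinal il, false).
  by exists (Ordinal il, true).
have [k f fcc f_inj|l1 l1l SSl1] :=
    @card_eq_II_bound _ [set SE | chain_control_set SS SE] (2 * l).
  have /choice[g gP] : forall i : 'I_k, exists p : 'I_l * bool,
      f i = chain_class (S := SS) (if p.2 then - c p.1 else c p.1).
    by move=> i; apply/SS_class/fcc.
  have g_inj : injective g.
    move=> i j gij; apply/val_inj/(f_inj i j (ltn_ord i) (ltn_ord j)).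
    by apply: (etrans (gP i)); rewrite gij; exact/esym/gP.
  have := leq_card g g_inj.
  by rewrite card_prod card_bool !card_ord mulnC.
exists l, l1; split=> //; last by rewrite leq_mul2l.
rewrite lt0n; apply/eqP => l10.
have [s ss] := exists_chain_recurrent.
move: SSl1; rewrite l10 II0 card_eq0 => /eqP SS0.
suff : [set SE | chain_control_set SS SE] (chain_class (S := SS) s).
  by rewrite SS0.
exact: chain_control_set_class.
Qed.

End linear_flows.

(** * Trajectories of the bilinear system *)

Section real_line_integrals.
Variable R : realType.
Local Notation mu := (@lebesgue_measure R).

Lemma measurable_translation (s : R) :
  measurable_fun [set: measurableTypeR R]
    (fun t : measurableTypeR R => s + t : measurableTypeR R).
Proof.
apply: continuous_measurable_fun => x.
by apply: cvgD; [exact: cvg_cst|exact: cvg_id].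
Qed.

Lemma lebesgue_measure_translation (s : R) (A : set (measurableTypeR R)) :
  measurable A ->
  pushforward mu (fun t : measurableTypeR R => s + t : measurableTypeR R) A = mu A.
Proof.
move=> mA; have mf := measurable_translation s.
apply/esym/(@lebesgue_measure_unique R
  (pushforward mu (fun t : measurableTypeR R => s + t : measurableTypeR R))) => //.
move=> _ [[a b]] _ <-.
have preE : (fun t : R => s + t) @^-1` `]a, b]%classic = `]a - s, b - s]%classic.
  by apply/seteqP; split=> t; rewrite /preimage/= !in_itv/= ltrBlDl lerBrDl.
rewrite -[RHS]/(mu ((fun t : R => s + t) @^-1` `]a, b]%classic)) preE.
rewrite !lebesgue_measure_itv/= !lte_fin ltrD2r.
by case: ifP => // _; rewrite -!EFinD; congr EFin; ring.
Qed.

Lemma ae_translation (s : R) (Q : R -> Prop) :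
  {ae mu, forall t, Q t} -> {ae mu, forall t, Q (s + t)}.
Proof.
move=> [B [mB B0 QB]]; exists ((fun t : R => s + t) @^-1` B); split.
- by rewrite -[X in measurable X]setTI; exact: measurable_translation.
- by rewrite -[RHS]B0 -[RHS](lebesgue_measure_translation s).
- by move=> t /= nQ; apply: QB.
Qed.

Lemma Rintegral_translation (s a b : R) (g : R -> R) :
  measurable_fun [set: measurableTypeR R] g ->
  mu.-integrable `[a, b] (EFin \o (fun t => g (s + t))) ->
  \int[mu]_(t in `[a, b]) g (s + t) = \int[mu]_(t in `[s + a, s + b]) g t.
Proof.
move=> mg ig; rewrite /Rintegral; congr fine.
have itvE : `[a, b]%classic = (fun t : R => s + t) @^-1` `[s + a, s + b]%classic.
  by apply/seteqP; split=> t; rewrite /preimage/= !in_itv/= !lerD2l.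
rewrite itvE in ig *; have mf := measurable_translation s.
have mgE : measurable_fun [set: measurableTypeR R] (EFin \o g).
  exact/measurable_EFinP.
rewrite -[LHS](integral_pushforward mf mgE ig); last exact: measurable_itv.
by apply/esym/eq_measure_integral => A mA _; exact/esym/lebesgue_measure_translation.
Qed.

Lemma ae_bounded_integral (a b C : R) (g : R -> R) : a <= b -> 0 <= C ->
  measurable_fun `[a, b] g ->
  {ae mu, forall t, t \in `[a, b] -> `|g t| <= C} ->
  mu.-integrable `[a, b] (EFin \o g) /\
  `|\int[mu]_(t in `[a, b]) g t| <= C * (b - a).
Proof.
move=> ab C0 mg gC.
have mab : measurable (`[a, b]%classic : set (measurableTypeR R)).
  exact: measurable_itv.
have mu_ab : mu `[a, b]%classic = (b - a)%:E.
  rewrite lebesgue_measure_itv/= lte_fin.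
  by move: ab; rewrite le_eqVlt => /predU1P[->|->//]; rewrite ltxx subrr.
have le_C : (\int[mu]_(t in `[a, b]) `|(g t)%:E| <= (C * (b - a))%:E)%E.
  rewrite EFinM -mu_ab -integral_cst//.
  apply: ae_ge0_le_integral => //.
  exact/measurableT_comp/measurable_EFinP.
have ig : mu.-integrable `[a, b] (EFin \o g).
  apply/integrableP; split; first exact/measurable_EFinP.
  by apply: le_lt_trans le_C _; exact: ltry.
split=> //; apply: le_trans (le_normr_Rintegral mab ig) _.
rewrite -lee_fin /Rintegral fineK//.
rewrite ge0_fin_numE; first by apply: le_lt_trans le_C _; exact: ltry.
exact: integral_ge0.
Qed.

Lemma ae_bounded_Lfun (C : R) (g : R -> R) :
  measurable_fun [set: measurableTypeR R] g ->
  {ae mu, forall t, `|g t| <= C} -> g \in Lfun mu +oo%E.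
Proof.
move=> mg gC; apply/andP; split; rewrite inE//= /finite_norm unlock.
case: ifP => _; last exact: ltry.
apply: le_lt_trans (ltry C); apply/ess_supP.
exact: gC.
Qed.

End real_line_integrals.

Section trajectories.
Variables (R : realType) (n m : nat).
Variables (A0 : 'M[R]_n.+1) (A : 'I_m -> 'M[R]_n.+1) (Omega : set 'cV[R]_m).
Hypotheses (Omega_compact : compact Omega) (Omega0 : Omega 0).
Local Notation V := 'cV[R]_n.+1.
Local Notation U := (admissible_controls Omega).
Local Notation mu := (@lebesgue_measure R).
Implicit Types (u : R -> 'cV[R]_m) (x y : V) (f g : R -> V).

Definition rhs u f (i : 'I_n.+1) (t : R) : R :=
  ((A0 + \sum_(j < m) u t j 0 *: A j) *m f t) i 0.

Lemma Omega_bounded : exists2 c : R, 0 < c & forall w, Omega w -> `|w| <= c.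
Proof.
have /ex_strict_bound_gt0[c c0 Oc] : bounded_set Omega.
  exact: compact_bounded.
by exists c => // w Ow; exact/ltW/Oc.
Qed.

Lemma rhs_bounded : exists2 M : R, 0 < M & forall u f i t, Omega (u t) ->
  `|rhs u f i t| <= M * `|f t|.
Proof.
have [c c0 Oc] := Omega_bounded.
pose M0 := `|A0| + \sum_(j < m) c * `|A j|.
have M00 : 0 <= M0 by rewrite addr_ge0// sumr_ge0// => j _; rewrite mulr_ge0// ltW.
exists (n.+1%:R * (M0 + 1)) => [|u f i t Ou].
  by rewrite mulr_gt0// ltr_wpDl.
rewrite /rhs mxE; apply: le_trans (ler_norm_sum _ _ _) _.
apply: (@le_trans _ _ (\sum_(k < n.+1) (M0 + 1) * `|f t|)); last first.
  by rewrite sumr_const card_ord -[_ *+ _]mulr_natl mulrA.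
apply: ler_sum => k _; rewrite normrM ler_pM ?coord_le_mx_norm//.
apply: le_trans (coord_le_mx_norm _ _ _) _.
apply: le_trans (_ : M0 <= _); last by rewrite lerDl.
apply: le_trans (ler_normD _ _) _; rewrite lerD2l.
apply: le_trans (ler_norm_sum _ _ _) _; apply: ler_sum => j _.
rewrite normrZ ler_wpM2r// (le_trans (coord_le_mx_norm _ _ _))//.
exact: Oc.
Qed.

Lemma admissible_measurable u j : U u ->
  measurable_fun [set: measurableTypeR R] (fun t => u t j 0).
Proof. by move=> [uL _]; have := sub_Lfun_mfun (uL j); rewrite inE. Qed.

Lemma admissible_controls_bounded u :
  (forall j, measurable_fun [set: measurableTypeR R] (fun t => u t j 0)) ->
  {ae mu, forall t, Omega (u t)} -> U u.
Proof.
move=> mu_u Ou; have [c c0 Oc] := Omega_bounded; split=> // j.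
apply: (ae_bounded_Lfun (C := c)) => //.
move: Ou; apply: (@filterS _ _ (ae_filter_ringOfSetsType mu)) => t /Oc.
by apply: le_trans; exact: coord_le_mx_norm.
Qed.

Lemma admissible_controls0 : U (fun=> 0).
Proof.
apply: admissible_controls_bounded => [j|].
  by under eq_fun do rewrite mxE; exact: measurable_cst.
exact: (@aeW _ _ _ mu).
Qed.

Lemma admissible_controls_shift s u : U u -> U (shift_control s u).
Proof.
move=> Uu; apply: admissible_controls_bounded => [j|].
  apply: (measurableT_comp (admissible_measurable j Uu)).
  exact: measurable_translation.
by apply: (@ae_translation R s (fun t => Omega (u t))); case: Uu.
Qed.

Lemma continuous_coord f i : continuous f -> continuous (fun t => f t i 0).
Proof.
move=> cf t; apply: (@continuous_comp _ _ _ f (fun v : V => v i 0)).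
  exact: cf.
exact: coord_continuous.
Qed.

Lemma rhs_measurable u f i : U u -> continuous f ->
  measurable_fun [set: measurableTypeR R] (rhs u f i).
Proof.
move=> Uu cf; rewrite /rhs; under eq_fun do rewrite mxE.
apply: measurable_sum => k; apply: measurable_funM.
  under eq_fun do rewrite mxE summxE.
  apply: measurable_funD; first exact: measurable_cst.
  apply: measurable_sum => j; under eq_fun do rewrite mxE.
  apply: measurable_funM; last exact: measurable_cst.
  exact: admissible_measurable.
by apply: continuous_measurable_fun; exact: continuous_coord.
Qed.

Lemma rhs_integral : exists2 M : R, 0 < M & forall u f i a b C,
  U u -> continuous f -> a <= b ->
  (forall t, t \in `[a, b] -> `|f t| <= C) ->
  mu.-integrable `[a, b] (EFin \o rhs u f i) /\
  `|\int[mu]_(t in `[a, b]) rhs u f i t| <= M * C * (b - a).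
Proof.
have [M M0 rhsM] := rhs_bounded; exists M => // u f i a b C Uu cf ab fC.
have C0 : 0 <= C.
  by apply: le_trans (fC a _); rewrite // in_itv/= lexx.
apply: ae_bounded_integral => //.
- by rewrite mulr_ge0// ltW.
- by apply: measurable_funTS; exact: rhs_measurable.
- have [_] := Uu; apply: (@filterS _ _ (ae_filter_ringOfSetsType mu)) => t Out tab.
  by rewrite (le_trans (rhsM _ _ _ _ Out))// ler_pM2l// fC.
Qed.

Lemma continuous_bounded_itv f a b : a <= b -> continuous f ->
  exists C, forall t, t \in `[a, b] -> `|f t| <= C.
Proof.
move=> ab cf.
have cnf : {within `[a, b], continuous (fun t => `|f t|)}.
  by apply: continuous_subspaceT => t; apply: cvg_norm; exact: cf.
by have [c _ fc] := EVT_max ab cnf; exists `|f c|.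
Qed.

Lemma rhs_integrable u f i a b : U u -> continuous f -> a <= b ->
  mu.-integrable `[a, b] (EFin \o rhs u f i).
Proof.
move=> Uu cf ab; have [M _ rhsM] := rhs_integral.
have [C fC] := continuous_bounded_itv ab cf.
by have [] := rhsM u f i a b C.
Qed.

Lemma is_trajectory_linear u c x y f g : U u ->
  is_trajectory A0 A u x f -> is_trajectory A0 A u y g ->
  is_trajectory A0 A u (c *: x + y) (fun t => c *: f t + g t).
Proof.
move=> Uu [fx cf fE] [gy cg gE]; split; first by rewrite fx gy.
  move=> t; apply: cvgD; last exact: cg.
  by apply: cvgZr; exact: cf.
move=> a b i ab.
have mab : measurable (`[a, b]%classic : set (measurableTypeR R)).
  exact: measurable_itv.
transitivity (\int[mu]_(t in `[a, b]) (c * rhs u f i t + rhs u g i t)); last first.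
  by apply: eq_Rintegral => t _; rewrite /rhs mulmxDr -scalemxAr !mxE.
have if_ := rhs_integrable i Uu cf ab; have ig := rhs_integrable i Uu cg ab.
have icf : mu.-integrable `[a, b] (EFin \o (fun t => c * rhs u f i t)).
  have -> : EFin \o (fun t => c * rhs u f i t) =
      (fun t => c%:E * (EFin \o rhs u f i) t)%E by [].
  exact: integrableZl.
rewrite RintegralD// RintegralZl// -fE// -gE// !mxE; ring.
Qed.

Lemma is_trajectory_shift u x f s : U u -> is_trajectory A0 A u x f ->
  is_trajectory A0 A (shift_control s u) (f s) (fun t => f (s + t)).
Proof.
move=> Uu [fx cf fE].
have cfs : continuous (fun t => f (s + t)).
  move=> t; apply: (@continuous_comp _ _ _ (fun t => s + t) f); last exact: cf.
  by apply: cvgD; [exact: cvg_cst|exact: cvg_id].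
split=> //; first by rewrite addr0.
move=> a b i ab; rewrite fE ?lerD2l//.
rewrite -(@Rintegral_translation R s a b (rhs u f i))//.
  exact: rhs_measurable.
exact: (@rhs_integrable (shift_control s u) (fun t => f (s + t)) i a b
  (admissible_controls_shift s Uu)).
Qed.

(* On an interval so short that the integral operator is a contraction, a
   trajectory vanishing at one point vanishes. *)
Lemma is_trajectory0 u f : U u -> is_trajectory A0 A u 0 f -> forall t, f t = 0.
Proof.
move=> Uu [f0 cf fE]; have [M M0 rhsM] := rhs_integral.
(* With this length [M * h] is one half, so the maximum of [|f|] near a zero is at most half of
   itself. *)
pose h := (M * 2)^-1.
have h0 : 0 < h by rewrite invr_gt0 mulr_gt0.
have local a : f a = 0 -> forall t, `|t - a| <= h -> f t = 0.
  move=> fa0.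
  have ah : a - h <= a + h by rewrite lerD2l; lra.
  have cnf : {within `[a - h, a + h], continuous (fun t => `|f t|)}.
    by apply: continuous_subspaceT => t; apply: cvg_norm; exact: cf.
  have [c cah fc] := EVT_max ah cnf.
  suff fc0 : `|f c| <= 0.
    move=> t ta; apply/eqP; rewrite -normr_le0 (le_trans _ fc0)// fc//.
    by rewrite in_itv/= -ler_distlC distrC.
  have bound p q i : a - h <= p -> p <= q -> q <= a + h -> q - p <= h ->
      `|f q i 0 - f p i 0| <= `|f c| / 2.
    move=> hp pq qh qph; rewrite fE//.
    have [|_] := rhsM u f i p q `|f c| Uu cf pq.
      move=> t; rewrite in_itv/= => /andP[pt tq]; apply: fc.
      by rewrite in_itv/= (le_trans hp)// (le_trans tq).
    move=> /le_trans; apply.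
    apply: (@le_trans _ _ (M * `|f c| * h)).
      by rewrite ler_wpM2l// mulr_ge0// ltW.
    have -> : M * `|f c| * h = `|f c| / 2 by rewrite /h; field; rewrite gt_eqF.
    exact: lexx.
  have fc2 : `|f c| <= `|f c| / 2.
    apply: mx_norm_le => [|i j]; first by rewrite divr_ge0.
    rewrite (ord1 j); move: cah; rewrite in_itv/= => /andP[hc ch].
    have [ac|/ltW ca] := leP a c.
      by have := bound a c i; rewrite fa0 mxE subr0; apply; lra.
    by have := bound c a i; rewrite fa0 mxE sub0r normrN; apply; lra.
  lra.
(* Vanishing spreads from 0 in both directions by intervals of the fixed length [h]. *)
have f_kh (k : nat) t : `|t| <= k%:R * h -> f t = 0.
  elim: k t => [|k IHk] t.
    by rewrite mul0r normr_le0 => /eqP ->.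
  rewrite -addn1 natrD mulrDl mul1r => tk.
  have [tkh|tkh] := leP `|t| (k%:R * h); first exact: IHk.
  have [t0|t0] := leP 0 t.
    rewrite (ger0_norm t0) in tk tkh.
    apply: (local (k%:R * h)); last by rewrite ger0_norm; lra.
    by apply: IHk; rewrite ger0_norm// mulr_ge0// ltW.
  rewrite (ltr0_norm t0) in tk tkh.
  apply: (local (- (k%:R * h))); last by rewrite ler0_norm; lra.
  by apply: IHk; rewrite normrN ger0_norm// mulr_ge0// ltW.
move=> t; apply: (f_kh (Num.bound (`|t| / h))).
by rewrite -ler_pdivrMr//; apply/ltW/archi_boundP; rewrite divr_ge0// ltW.
Qed.

Lemma is_trajectory_unique u x f g : U u -> is_trajectory A0 A u x f ->
  is_trajectory A0 A u x g -> forall t, f t = g t.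
Proof.
move=> Uu ftr gtr t; have := is_trajectory_linear (-1) Uu ftr gtr.
rewrite scaleN1r addNr => /(is_trajectory0 Uu)/(_ t)/eqP.
by rewrite scaleN1r addrC subr_eq0 eq_sym => /eqP.
Qed.

(** Linearity and the cocycle identity follow from uniqueness: both sides are trajectories for the
    same control with the same initial value. *)
Lemma trajectories_linear_control_flow (phi : R -> V -> (R -> 'cV[R]_m) -> V) :
  (forall x u, U u -> is_trajectory A0 A u x (fun t => phi t x u)) ->
  linear_control_flow U phi.
Proof.
move=> phi_tr; split.
- exact: admissible_controls0.
- by move=> s u; exact: admissible_controls_shift.
- move=> u t c x y Uu.
  apply: (is_trajectory_unique (f := fun t => phi t (c *: x + y) u)
    (g := fun t => c *: phi t x u + phi t y u) Uu (phi_tr _ _ Uu)).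
  by apply: is_trajectory_linear => //; exact: phi_tr.
- by move=> u x /(phi_tr x)[].
- move=> u s t x Uu; have Us := admissible_controls_shift s Uu.
  apply: (is_trajectory_unique (f := fun t => phi (s + t) x u)
    (g := fun t => phi t (phi s x u) (shift_control s u)) Us _ (phi_tr _ _ Us)).
  exact: (is_trajectory_shift s Uu (phi_tr x u Uu)).
Qed.

End trajectories.

Theorem theorem8 (R : realType) (n m : nat)
    (A0 : 'M[R]_n.+1) (A : 'I_m -> 'M[R]_n.+1)
    (Omega : set 'cV[R]_m)
    (Omega_convex : convex_set Omega)
    (Omega_compact : compact Omega)
    (Omega_nbhs : nbhs (0 : 'cV[R]_m) Omega)
    (phi : R -> 'cV[R]_n.+1 -> (R -> 'cV[R]_m) -> 'cV[R]_n.+1)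
    (phi_trajectory : forall x u, admissible_controls Omega u ->
       is_trajectory A0 A u x (fun t => phi t x u))
    (N : 'cV[R]_n.+1 -> R) (N_norm : is_norm N) :
  let U := admissible_controls Omega in
  let SS := sphere_system N phi U in
  let PS := proj_system N phi U in
  (forall PE : set {vspace 'cV[R]_n.+1}, chain_control_set PS PE ->
    let SE0 := sphere_lift PE in
    let case_i :=
      chain_control_set SS SE0 /\
      (forall F, chain_control_set SS F ->
         (forall s, F s -> PE <[s]>%VS) -> F = SE0) in
    let case_ii SE1 SE2 :=
      [/\ chain_control_set SS SE1, chain_control_set SS SE2,
          SE1 <> SE2, SE1 = [set - s | s in SE2] & SE1 `|` SE2 = SE0] in
    [/\ (* (i) *)
        case_i <->
        (exists s0, [/\ unit_sphere s0, PE <[s0]>%VS &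
                        chain_reachable SS s0 (- s0)]),
        (* (ii) *)
        (exists SE1 SE2, case_ii SE1 SE2) <->
        (forall s0, unit_sphere s0 -> PE <[s0]>%VS ->
                    ~ chain_reachable SS s0 (- s0)),
        (* (iii), case (i) *)
        case_i -> forall u, U u ->
          exists W : {vspace 'cV[R]_n.+1},
            stays_in phi SE0 u `|` [set 0] = [set x | x \in W] &
        (* (iii), case (ii) *)
        forall SE1 SE2, case_ii SE1 SE2 ->
          forall E, E = SE1 \/ E = SE2 -> forall u, U u ->
          forall x1 x2 (alpha beta : R),
            stays_in phi E u x1 -> stays_in phi E u x2 ->
            0 < alpha -> 0 < beta ->
            stays_in phi E u (alpha *: x1 + beta *: x2)]) /\
  (* (iv) *)
  (exists l l1 : nat,
    [/\ ([set PE | chain_control_set PS PE] #= `I_l)%card,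
        ([set SE | chain_control_set SS SE] #= `I_l1)%card,
        (1 <= l1)%N, (l1 <= 2 * l)%N & (2 * l <= 2 * n.+1)%N]).
Proof.
move=> U SS PS.
have phiP : linear_control_flow U phi.
  apply: (trajectories_linear_control_flow Omega_compact
    (nbhs_singleton Omega_nbhs)).
  exact: phi_trajectory.
split; last exact: (chain_control_sets_count N_norm phiP).
move=> PE PEcc SE0 case_i case_ii.
have case_iP : case_i <-> chain_control_set SS SE0.
  split=> [[]//|SE0cc]; split=> // F Fcc FP.
  exact: (sphere_lift_unique SE0cc Fcc FP).
split.
- apply: (iff_trans case_iP).
  exact: (sphere_lift_chain_control_setP N_norm phiP PEcc).
- exact: (sphere_lift_splitP N_norm phiP PEcc).
- move=> /case_iP SE0cc u Uu.
  exact: (stays_in_lift_vspace N_norm phiP Uu SE0cc).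
- move=> SE1 SE2 SE12 E E12 u Uu x1 x2 alpha beta Ex1 Ex2 al be.
  have [SE1cc SE2cc _ _ SE12U] := SE12.
  have nN : forall s0, unit_sphere s0 -> PE <[s0]>%VS ->
      ~ chain_reachable SS s0 (- s0).
    by apply/(sphere_lift_splitP N_norm phiP PEcc); exists SE1, SE2.
  apply: (stays_in_convex_cone N_norm phiP (PE := PE)) Uu Ex1 Ex2 al be.
  + by case: E12 => ->.
  + by rewrite -/SE0 -SE12U => s Es; case: E12 Es => ->; [left|right].
  + by move=> s [s1 Ps]; exact: nN.
Qed.
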